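(* For every constant $k$, the SBFE problem for monotone $k$-term DNF formulas, with an arbitrary product distribution on the input $x$ and arbitrary costs, can be solved exactly (i.e., an optimal testing strategy of minimum expected cost can be computed) in time polynomial in $n$.
   Context: SBFE problem: given a formula for $f(x_1,\ldots,x_n)$, probabilities $p=(p_1,\ldots,p_n)$ with $0<p_i<1$ and costs $c=(c_1,\ldots,c_n)$ with $c_i\ge 0$, an unknown $x\in\{0,1\}^n$ is drawn from the product distribution $D_p$ ($\Pr[x_i=1]=p_i$ independently); the value of $x_i$ is learned only by testing it at cost $c_i$; tests are performed sequentially and adaptively until $f(x)$ is determined (i.e., a decision tree computing $f$ is followed), and the goal is to minimize the expected total cost. A monotone $k$-term DNF is a disjunction of at most $k$ terms, each a conjunction of unnegated variables. *)

(* Defs.v *)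
From HB Require Import structures.
From mathcomp Require Import all_boot all_order all_algebra.

Set Implicit Arguments.
Unset Strict Implicit.
Unset Printing Implicit Defensive.

Import Order.TTheory GRing.Theory Num.Theory.
Local Open Scope ring_scope.

(** * Monotone DNF formulas *)

(* A term is the set of its variables; the empty term is the constant true and
   the formula without terms is the constant false. *)
Definition mdnf (n : nat) := seq {set 'I_n}.

Definition assignment (n : nat) := {ffun 'I_n -> bool}.

Definition mdnf_eval n (F : mdnf n) (x : assignment n) : bool :=
  has (fun A : {set 'I_n} => [forall i in A, x i]) F.

(** * Testing strategies *)

Inductive dtree (n : nat) : Type :=
| Leaf of bool
| Test of 'I_n & dtree n & dtree n.
Arguments Leaf {n} _.

(* In [Test i t0 t1], [t0] is followed when x_i = 0 and [t1] when x_i = 1. *)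
Fixpoint dt_eval n (t : dtree n) (x : assignment n) : bool :=
  match t with
  | Leaf b => b
  | Test i t0 t1 => if x i then dt_eval t1 x else dt_eval t0 x
  end.

Definition dt_computes n (t : dtree n) (F : mdnf n) : Prop :=
  forall x, dt_eval t x = mdnf_eval F x.

Section Cost.
Variables (R : realFieldType) (n : nat).
Implicit Types (p c : 'I_n -> R).

(* Total cost of the tests made on x; a repeated test is paid for again. *)
Fixpoint dt_cost c (t : dtree n) (x : assignment n) : R :=
  match t with
  | Leaf _ => 0
  | Test i t0 t1 => c i + (if x i then dt_cost c t1 x else dt_cost c t0 x)
  end.

Definition prod_prob p (x : assignment n) : R :=
  \prod_(i < n) (if x i then p i else 1 - p i).

Definition expected_cost p c (t : dtree n) : R :=
  \sum_(x : assignment n) prod_prob p x * dt_cost c t x.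

Definition optimal_strategy p c (F : mdnf n) (t : dtree n) : Prop :=
  dt_computes t F /\
  forall t' : dtree n, dt_computes t' F ->
    expected_cost p c t <= expected_cost p c t'.

End Cost.

(** * Algorithms

   Structured programs for the real RAM.  Memory consists of arrays of natural
   numbers and arrays of field elements, with indirect addressing.  To keep the
   unit-cost measure reasonable, naturals only have addition, truncated
   subtraction and comparison, so that their bit length grows by at most a
   constant per step, and field elements only have the field operations and
   comparison: neither rounding nor conversion to a natural number.  Programs
   contain no field constants other than 0 and 1. *)

Inductive nexp : Type :=
| NConst of nat
| NGet of nat & nexp              (* array name, index *)
| NAdd of nexp & nexp
| NSub of nexp & nexp.

Inductive rexp : Type :=
| RZero
| ROne
| RGet of nat & nexp              (* array name, index *)
| RAdd of rexp & rexp
| RSub of rexp & rexp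
| RMul of rexp & rexp
| RDiv of rexp & rexp.

Inductive bexp : Type :=
| BLeN of nexp & nexp
| BLeR of rexp & rexp
| BNot of bexp
| BAnd of bexp & bexp.

Inductive cmd : Type :=
| Skip
| NSet of nat & nexp & nexp       (* array name, index, value *)
| RSet of nat & nexp & rexp       (* array name, index, value *)
| Seq of cmd & cmd
| If of bexp & cmd & cmd
| While of bexp & cmd.

Definition memory (A : Type) := nat -> nat -> A.

Definition mem_set A (m : memory A) (a j : nat) (v : A) : memory A :=
  fun a' j' => if (a' == a) && (j' == j) then v else m a' j'.

Record store (R : Type) := Store { nmem : memory nat; rmem : memory R }.

Section Semantics.
Variable R : realFieldType.
Implicit Types s : store R.

Fixpoint neval s (e : nexp) : nat :=
  match e with
  | NConst v => v
  | NGet a e1 => nmem s a (neval s e1)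
  | NAdd e1 e2 => (neval s e1 + neval s e2)%N
  | NSub e1 e2 => (neval s e1 - neval s e2)%N
  end.

Fixpoint reval s (e : rexp) : R :=
  match e with
  | RZero => 0
  | ROne => 1
  | RGet a e1 => rmem s a (neval s e1)
  | RAdd e1 e2 => reval s e1 + reval s e2
  | RSub e1 e2 => reval s e1 - reval s e2
  | RMul e1 e2 => reval s e1 * reval s e2
  | RDiv e1 e2 => reval s e1 / reval s e2
  end.

Fixpoint beval s (b : bexp) : bool :=
  match b with
  | BLeN e1 e2 => (neval s e1 <= neval s e2)%N
  | BLeR e1 e2 => reval s e1 <= reval s e2
  | BNot b1 => ~~ beval s b1
  | BAnd b1 b2 => beval s b1 && beval s b2
  end.

End Semantics.

(* Evaluating an expression takes one step per node. *)
Fixpoint nsize (e : nexp) : nat :=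
  match e with
  | NConst _ => 1
  | NGet _ e1 => (nsize e1).+1
  | NAdd e1 e2 | NSub e1 e2 => (nsize e1 + nsize e2).+1
  end.

Fixpoint rsize (e : rexp) : nat :=
  match e with
  | RZero | ROne => 1
  | RGet _ e1 => (nsize e1).+1
  | RAdd e1 e2 | RSub e1 e2 | RMul e1 e2 | RDiv e1 e2 =>
      (rsize e1 + rsize e2).+1
  end.

Fixpoint bsize (b : bexp) : nat :=
  match b with
  | BLeN e1 e2 => (nsize e1 + nsize e2).+1
  | BLeR e1 e2 => (rsize e1 + rsize e2).+1
  | BNot b1 => (bsize b1).+1
  | BAnd b1 b2 => (bsize b1 + bsize b2).+1
  end.

(* [exec P s t s']: started in store s, P halts after t steps in store s'. *)
Inductive exec (R : realFieldType) :
    cmd -> store R -> nat -> store R -> Prop :=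
| ExecSkip s : exec Skip s 1 s
| ExecNSet a e1 e2 s :
    exec (NSet a e1 e2) s (nsize e1 + nsize e2).+1
      (Store (mem_set (nmem s) a (neval s e1) (neval s e2)) (rmem s))
| ExecRSet a e1 e2 s :
    exec (RSet a e1 e2) s (nsize e1 + rsize e2).+1
      (Store (nmem s) (mem_set (rmem s) a (neval s e1) (reval s e2)))
| ExecSeq P1 P2 s s1 s2 t1 t2 :
    exec P1 s t1 s1 -> exec P2 s1 t2 s2 ->
    exec (Seq P1 P2) s (t1 + t2) s2
| ExecIf b P1 P2 s s1 t :
    exec (if beval s b then P1 else P2) s t s1 ->
    exec (If b P1 P2) s (bsize b + t).+1 s1
| ExecWhileStop b P s :
    ~~ beval s b ->
    exec (While b P) s (bsize b).+1 s
| ExecWhileStep b P s s1 s2 t1 t2 :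
    beval s b -> exec P s t1 s1 -> exec (While b P) s1 t2 s2 ->
    exec (While b P) s (bsize b + t1 + t2).+1 s2.

(** * Input and output conventions *)

(* Natural-number arrays. *)
Definition arr_nvars := 0%N.    (* input, cell 0: the number n of variables *)
Definition arr_nterms := 1%N.   (* input, cell 0: the number of terms *)
Definition arr_formula := 2%N.  (* input: cell j * n + i is 1 iff the j-th term
                                   contains x_i *)
Definition arr_root := 3%N.     (* output, cell 0: address of the root *)
Definition arr_label := 4%N.    (* output: label of each node *)
Definition arr_child0 := 5%N.   (* output: addresses of the 0-children *)
Definition arr_child1 := 6%N.   (* output: addresses of the 1-children *)

(* Field arrays. *)
Definition arr_prob := 0%N.     (* input: cell i is p_i *)
Definition arr_cost := 1%N.     (* input: cell i is c_i *)

Definition formula_bits n (F : mdnf n) : seq nat :=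
  flatten [seq [seq nat_of_bool (i \in A) | i <- enum 'I_n] | A : {set 'I_n} <- F].

(* All other memory cells are initially 0. *)
Definition input_store (R : realFieldType) n (F : mdnf n) (p c : 'I_n -> R) :
    store R :=
  Store
    (fun a => nth 0%N (if a == arr_nvars then [:: n]
                       else if a == arr_nterms then [:: size F]
                       else if a == arr_formula then formula_bits F
                       else [::]))
    (fun a => nth 0 (if a == arr_prob then [seq p i | i <- enum 'I_n]
                     else if a == arr_cost then [seq c i | i <- enum 'I_n]
                     else [::])).

(* [stored_tree m v t]: the linked structure in m rooted at address v represents
   the tree t.  The label of a leaf is its value 0 or 1, and the label of a node
   testing x_i is i + 2; equal subtrees may be shared. *)
Inductive stored_tree n (m : memory nat) : nat -> dtree n -> Prop :=
| StoredLeaf v (b : bool) :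
    m arr_label v = b :> nat -> stored_tree m v (Leaf b)
| StoredTest v (i : 'I_n) t0 t1 :
    m arr_label v = i.+2 ->
    stored_tree m (m arr_child0 v) t0 ->
    stored_tree m (m arr_child1 v) t1 ->
    stored_tree m v (Test i t0 t1).

Definition outputs_tree (R : realFieldType) n (s : store R) (t : dtree n) : Prop :=
  stored_tree (nmem s) (nmem s arr_root 0%N) t.

(* Main.v *)
(* Once variables are found to be 1 or 0, what remains is again a monotone DNF.
   The variables lying in exactly the same terms form at most 2^k classes.
   Inside a class it is optimal to test by increasing ratio c_i / (1 - p_i): if a
   precedes b in this order and b were tested first, then an optimal first test y
   after x_b = 1 costs at least as little right away, because testing a there
   was not better (an induction on the number of variables, see exchange_ineq).
   Hence only states matter that record, for each class, either how many of its
   first variables are known to be 1, or that one of them is known to be 0.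
   There are (n + 2) ^ (2 ^ k) of them; numbered in base n + 2 with one digit per
   class, a test always leads to a larger number, so that a table of optimal
   values filled from the largest number downwards is a dynamic program.  The
   number of a state also serves as the address of its node, and the root is 0. *)

Require Import Defs.
From mathcomp Require Import all_boot all_order all_algebra.
From mathcomp Require Import ring zify.

Set Implicit Arguments.
Unset Strict Implicit.
Unset Printing Implicit Defensive.

Import Order.TTheory GRing.Theory Num.Theory.
Local Open Scope ring_scope.

(** * Residual formulas *)

(** The obstacle to the exchange is that in an optimal tree starting with x_b, the test of x_a may
    lie at different depths on different branches or be missing, so the two tests cannot simply be
    swapped. The exchange therefore never touches trees: it works with [opt], the value function on
    residual formulas, and looks at one test at a time. The inequality carried by the induction is
    what optimality yields when the first test after x_b = 1 is x_a, and it passes through any other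
    test by averaging over its outcome. Trees enter only afterwards, to show that [opt] bounds every
    strategy from below and that the table attains it. Variables from different classes of the
    original formula may come to lie in the same terms of a residual one. The order of tests is
    proved for these coarser residual classes and then applied inside the original classes, which
    stay fixed and so can serve as digit positions. The machine neither multiplies nor divides
    naturals, so powers and digits are obtained by counting. Every loop still makes at most as many
    rounds as there are states, so one bound [u] controls the running time. *)

Section Residual.
Variable n : nat.
Implicit Types (G : mdnf n) (i j : 'I_n).

Definition fix1 i G : mdnf n := [seq A :\ i | A : {set 'I_n} <- G].
Definition fix0 i G : mdnf n := [seq A : {set 'I_n} <- G | i \notin A].

Definition support G : {set 'I_n} := [set i | has (fun A : {set 'I_n} => i \in A) G].

Definition same_terms G i j :=
  all (fun A : {set 'I_n} => (i \in A) == (j \in A)) G.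

Lemma supportP G i :
  reflect (exists2 A : {set 'I_n}, A \in G & i \in A) (i \in support G).
Proof. by rewrite inE; apply: hasP. Qed.

Lemma same_termsP G i j :
  reflect {in G, forall A : {set 'I_n}, (i \in A) = (j \in A)} (same_terms G i j).
Proof.
apply: (iffP allP) => H A AG; first by apply/eqP/H.
by apply/eqP/H.
Qed.

Lemma same_terms_sym G i j : same_terms G i j -> same_terms G j i.
Proof. by move/same_termsP=> H; apply/same_termsP=> A /H. Qed.

Lemma same_terms_trans G i j l :
  same_terms G i j -> same_terms G j l -> same_terms G i l.
Proof.
move=> /same_termsP H1 /same_termsP H2; apply/same_termsP=> A AG.
by rewrite H1 // H2.
Qed.

Lemma same_terms_support G i j :
  same_terms G i j -> (i \in support G) = (j \in support G).
Proof.
move=> /same_termsP H; rewrite !inE.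
by apply: eq_in_has => A AG; rewrite H.
Qed.

Lemma support_fix1 G i : support (fix1 i G) = support G :\ i.
Proof.
apply/setP=> j; rewrite !inE has_map.
rewrite -(@eq_has _ (fun A : {set 'I_n} => (j != i) && (j \in A))); last first.
  by move=> A /=; rewrite !inE.
by case: (j != i) => //=; elim: G.
Qed.

Lemma support_fix0 G i : support (fix0 i G) \subset support G :\ i.
Proof.
apply/subsetP=> j /supportP[A]; rewrite mem_filter => /andP[iA AG] jA.
rewrite !inE; apply/andP; split; last by apply/hasP; exists A.
by apply: contraNneq iA => <-.
Qed.

Lemma fix1_out G i : i \notin support G -> fix1 i G = G.
Proof.
move=> iG; rewrite -[RHS]map_id; apply/eq_in_map => A AG.
apply/setP=> j; rewrite !inE andbC; case: eqP => [->|]; last by rewrite andbT.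
by rewrite andbF; apply/esym/negP=> iA; case/supportP: iG; exists A.
Qed.

Lemma fix0_out G i : i \notin support G -> fix0 i G = G.
Proof.
move=> iG; apply/all_filterP/allP=> A AG.
by apply/negP=> iA; case/supportP: iG; exists A.
Qed.

Lemma fix11C G i j : fix1 i (fix1 j G) = fix1 j (fix1 i G).
Proof.
rewrite /fix1 -!map_comp; apply: eq_map => A /=.
by apply/setP=> l; rewrite !inE andbCA.
Qed.

Lemma fix10C G i j : i != j -> fix1 i (fix0 j G) = fix0 j (fix1 i G).
Proof.
move=> ij; rewrite /fix1 /fix0 filter_map; congr map; apply: eq_filter => A /=.
by rewrite !inE eq_sym ij.
Qed.

Lemma same_terms_fix1 G l i j : i != l -> j != l ->
  same_terms (fix1 l G) i j = same_terms G i j.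
Proof.
move=> il jl; rewrite /same_terms all_map; apply: eq_all => A /=.
by rewrite !inE il jl.
Qed.

Lemma same_terms_fix0 G l i j : same_terms G i j -> same_terms (fix0 l G) i j.
Proof.
by move/same_termsP=> H; apply/same_termsP=> A; rewrite mem_filter => /andP[_ /H].
Qed.

Lemma same_terms_eq_fix0 G i j : same_terms G i j -> fix0 i G = fix0 j G.
Proof. by move/same_termsP=> H; apply: eq_in_filter => A /H ->. Qed.

(** A term survives x_i = 0 only if it lacks i, hence also j: one zero settles a whole class. *)
Lemma notin_support_fix0 G i j : same_terms G i j -> j \notin support (fix0 i G).
Proof.
move=> ij; rewrite (same_terms_eq_fix0 ij); apply/negP.
by move/(subsetP (support_fix0 _ _)); rewrite !inE eqxx.
Qed.

Lemma set0_fix1 G i : set0 \in G -> set0 \in fix1 i G.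
Proof. by move=> H; apply/mapP; exists set0; rewrite ?set0D. Qed.

(* A term containing i still contains j after x_i is found to be true. *)
Lemma set0_notin_fix1 G i j : i != j -> same_terms G i j ->
  set0 \notin G -> set0 \notin fix1 i G.
Proof.
move=> ij /same_termsP Hij; apply: contra => /mapP[A AG] A0.
suff -> : set0 = A by [].
rewrite [LHS]A0; apply/setP => l; rewrite !inE; case: eqP => [->|] //=.
rewrite Hij //; apply/esym/negP => jA.
by have := in_set0 j; rewrite A0 !inE eq_sym ij jA.
Qed.

Lemma support_neq0 G : set0 \notin G -> G != [::] -> exists i, i \in support G.
Proof.
case: G => [//|A G]; rewrite inE negb_or eq_sym => /andP[/set0Pn[i iA] _] _.
by exists i; apply/supportP; exists A; rewrite ?inE ?eqxx.
Qed.

End Residual.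

(** * Optimal values and the order of tests inside a class *)

Section Opt.
Variables (R : realFieldType) (n : nat) (p c : 'I_n -> R).
Hypothesis p01 : forall i, 0 < p i < 1.
Hypothesis c_ge0 : forall i, 0 <= c i.
Implicit Types (G : mdnf n) (i j a b y : 'I_n).

Definition test_value (v : mdnf n -> R) G i :=
  c i + (p i * v (fix1 i G) + (1 - p i) * v (fix0 i G)).

(** The Bellman recursion on residual formulas. The fuel [d] has to cover the size of the support,
    so [n] always suffices. *)
Fixpoint opt_rec d G : R :=
  if d is d'.+1 then
    if set0 \in G then 0 else
    if [pick i in support G |
          [forall j in support G, test_value (opt_rec d') G i
                                  <= test_value (opt_rec d') G j]] is Some i
    then test_value (opt_rec d') G i else 0
  else 0.

Definition opt G := opt_rec n G.
Definition test_opt := test_value opt.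

Lemma p_ge0 i : 0 <= p i. Proof. by case/andP: (p01 i) => /ltW. Qed.
Lemma q_gt0 i : 0 < 1 - p i. Proof. by rewrite subr_gt0; case/andP: (p01 i). Qed.
Lemma q_ge0 i : 0 <= 1 - p i. Proof. exact/ltW/q_gt0. Qed.

Lemma card_fix1 G i d : i \in support G -> (#|support G| <= d.+1)%N ->
  (#|support (fix1 i G)| <= d)%N.
Proof. by move=> iG; rewrite (cardsD1 i) iG support_fix1. Qed.

Lemma card_fix0 G i d : i \in support G -> (#|support G| <= d.+1)%N ->
  (#|support (fix0 i G)| <= d)%N.
Proof.
move=> iG; rewrite (cardsD1 i) iG ltnS; apply: leq_trans.
exact/subset_leq_card/support_fix0.
Qed.

Lemma card_fix1_lt G i : i \in support G ->
  (#|support (fix1 i G)| < #|support G|)%N.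
Proof. by move=> iG; rewrite [X in (_ < X)%N](cardsD1 i) iG support_fix1. Qed.

Lemma card_fix0_lt G i : i \in support G ->
  (#|support (fix0 i G)| < #|support G|)%N.
Proof.
move=> iG; rewrite [X in (_ < X)%N](cardsD1 i) iG ltnS.
exact/subset_leq_card/support_fix0.
Qed.

Lemma opt_rec_stable d e G : (#|support G| <= d)%N -> (#|support G| <= e)%N ->
  opt_rec d G = opt_rec e G.
Proof.
elim: d e G => [|d IH] [|e] G //=.
- rewrite leqn0 cards_eq0 => /eqP G0 _; case: ifP => // _.
  by case: pickP => // i; rewrite G0 inE.
- move=> _; rewrite leqn0 cards_eq0 => /eqP G0; case: ifP => // _.
  by case: pickP => // i; rewrite G0 inE.
move=> Hd He; case: ifP => // _.
have E i : i \in support G ->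
    test_value (opt_rec d) G i = test_value (opt_rec e) G i.
  move=> iG; rewrite /test_value.
  by rewrite (IH e (fix1 i G)) ?(IH e (fix0 i G)) ?card_fix1 ?card_fix0.
have -> : [pick i in support G |
          [forall j in support G, test_value (opt_rec d) G i
                                  <= test_value (opt_rec d) G j]]
   = [pick i in support G |
          [forall j in support G, test_value (opt_rec e) G i
                                  <= test_value (opt_rec e) G j]].
  apply: eq_pick => i; case: (boolP (i \in support G)) => //= iG.
  by apply: eq_forallb => j; case: (boolP (j \in support G)) => //= jG; rewrite !E.
by case: pickP => // i /andP[iG _]; rewrite E.
Qed.

Lemma opt_set0 G : set0 \in G -> opt G = 0.
Proof.
move=> G0; suff H d : opt_rec d G = 0 by exact: H.
by case: d => //= d; rewrite G0.
Qed.

Lemma opt_nil : opt [::] = 0.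
Proof.
rewrite /opt; suff H : forall d, opt_rec d [::] = 0 by exact: H.
by case=> //= d; case: pickP => // i /andP[]; rewrite inE.
Qed.

Lemma opt_supp G : set0 \notin G -> G != [::] ->
  exists2 i, i \in support G &
    opt G = test_opt G i /\ {in support G, forall j, opt G <= test_opt G j}.
Proof.
move=> G0 /(support_neq0 G0)[i0 i0G].
have cG : (#|support G| <= n)%N by rewrite -[X in (_ <= X)%N]card_ord max_card.
(* A variable exists, so [n] is a successor. One level of recursion spends one unit of fuel, and [d]
   still covers both residual formulas. *)
set d := n.-1; have nE : n = d.+1 by rewrite /d; case: (n) i0 {i0G} => // [[]].
have E i : i \in support G -> test_opt G i = test_value (opt_rec d) G i.
  move=> iG; rewrite /test_opt /test_value /opt.
  have cG' : (#|support G| <= d.+1)%N by rewrite -nE.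
  have c1 := card_fix1 iG cG'; have c0 := card_fix0 iG cG'.
  have le_dn : (d <= n)%N by rewrite nE.
  by rewrite (@opt_rec_stable n d) ?(@opt_rec_stable n d (fix0 i G)) //;
     exact: leq_trans le_dn.
have oE : opt G = opt_rec d.+1 G by rewrite -nE.
rewrite oE /= (negbTE G0); case: pickP => [i /andP[iG /forallP Hi]|H].
  exists i => //; split; first by rewrite E.
  by move=> j jG; rewrite E //; have := Hi j; rewrite jG.
case: (@arg_minP _ _ _ i0 (mem (support G)) (test_value (opt_rec d) G) i0G) => i iG Hi.
have := H i; rewrite (iG : i \in support G) /= => /negP[].
by apply/forallP=> j; apply/implyP=> /Hi.
Qed.

Lemma opt_ge0 G : 0 <= opt G.
Proof.
elim: {G}_.+1 {-2}G (ltnSn #|support G|) => // d IH G; rewrite ltnS => cG.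
have [/opt_set0 -> //|G0] := boolP (set0 \in G).
have [->|GN] := eqVneq G [::]; first by rewrite opt_nil.
have [i iG [-> _]] := opt_supp G0 GN.
have := IH _ (leq_trans (card_fix1_lt iG) cG).
have := IH _ (leq_trans (card_fix0_lt iG) cG) => h0 h1.
by rewrite addr_ge0 ?c_ge0 // addr_ge0 // mulr_ge0 ?p_ge0 ?q_ge0.
Qed.

Lemma test_opt_out G i : i \notin support G -> test_opt G i = c i + opt G.
Proof.
move=> iG; rewrite /test_opt /test_value fix1_out // fix0_out //; ring.
Qed.

Lemma test_opt_ge0 G i : 0 <= test_opt G i.
Proof.
by rewrite addr_ge0 ?c_ge0 // addr_ge0 // mulr_ge0 ?p_ge0 ?q_ge0 ?opt_ge0.
Qed.

(** Outside the support a test merely adds its cost, so the bound holds for every variable.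
    Candidates therefore need not be checked for occurring in the residual formula. *)
Lemma opt_le_test G i : opt G <= test_opt G i.
Proof.
have [/opt_set0 -> |G0] := boolP (set0 \in G); first exact: test_opt_ge0.
have [->|GN] := eqVneq G [::]; first by rewrite opt_nil test_opt_ge0.
have [iG|iG] := boolP (i \in support G); last by rewrite test_opt_out // lerDr.
by have [j _ [_]] := opt_supp G0 GN; apply.
Qed.

(** * The exchange inequality *)

Definition ratio i := c i / (1 - p i).

Lemma le_ratio i j : (ratio i <= ratio j) = (c i * (1 - p j) <= c j * (1 - p i)).
Proof. by rewrite /ratio ler_pdivrMr ?q_gt0 // mulrAC ler_pdivlMr ?q_gt0. Qed.

(* For a and b in the same terms, a with the better ratio, this compares the
   benefit of knowing x_b = 1 with that of then also knowing x_a = 1. *)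
Definition exchange_bound G a b :=
  p a * (c b * (1 - p a) - c a * (1 - p b))
  + p a * (1 - p b) * (opt (fix1 b G) - opt (fix1 b (fix1 a G))).

(** Reduces a goal to a linear combination of known inequalities, leaving an identity to [ring]. *)
Lemma ler_diff (u v w z : R) : v - u = z - w -> w <= z -> u <= v.
Proof. by move=> E; rewrite -subr_ge0 -E subr_ge0. Qed.

(** The premise on [H] is the bound of [exchange_ineq] with [H] in place of [G]. Keeping it abstract
    lets one computation serve both in that induction and, once the bound is proved, in
    [exchange]. *)
Lemma exchange_step G a b y : a != b -> same_terms G a b ->
  y != b -> opt (fix1 b G) = test_opt (fix1 b G) y ->
  ratio a <= ratio b ->
  (y != a -> forall H, H = fix1 y G \/ H = fix0 y G ->
     (1 - p a) * (opt H - opt (fix1 b H)) <= exchange_bound H a b) ->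
  (1 - p a) * (test_opt G y - opt (fix1 b G)) <= exchange_bound G a b.
Proof.
move=> ab Gab yb Ey; rewrite le_ratio => rab.
have := p_ge0 a; have := q_gt0 a; have := p_ge0 b; have := q_gt0 b => qb pb qa pa.
have Gba := same_terms_sym Gab; have ba : b != a by rewrite eq_sym.
(* For y = a the 0-branches cancel, since x_a = 0 removes every term containing b. What remains is
   the difference at x_a = 1, which is bounded by testing b there. *)
have [ya _|ya IH] := eqVneq y a.
  have Eb : fix0 a (fix1 b G) = fix0 a G.
    by rewrite -fix10C // fix1_out // notin_support_fix0.
  have Ea : fix0 b (fix1 a G) = fix0 a G.
    by rewrite -fix10C // -(same_terms_eq_fix0 Gab) fix1_out //
      (same_terms_eq_fix0 Gab) notin_support_fix0.
  have := opt_le_test (fix1 a G) b.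
  rewrite /exchange_bound; move: Ey; rewrite ya /test_opt /test_value Eb Ea.
  rewrite (fix11C _ a b) => -> H.
  apply: ler_diff (ler_wpM2l (mulr_ge0 pa (ltW qa)) H); ring.
(* For any other y, the bounds for its two outcomes are averaged, and testing y bounds the value
   after x_a = x_b = 1 from above. *)
have IH1 := IH isT _ (or_introl erefl); have IH0 := IH isT _ (or_intror erefl).
have := opt_le_test (fix1 b (fix1 a G)) y.
move: IH1 IH0; rewrite /exchange_bound; move: Ey; rewrite /test_opt /test_value.
have [y_b y_a] : b != y /\ a != y by rewrite !(eq_sym _ y).
rewrite (fix11C G y b) (fix11C (fix1 a G) y b) (fix11C G y a).
rewrite -(fix10C _ y_b) -(fix10C _ y_b) -(fix10C _ y_a).
set Vb := opt (fix1 b G); set Vab := opt (fix1 b (fix1 a G)) => ->.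
have := p_ge0 y; have := q_ge0 y => qy py IH1 IH0 Hy.
apply: ler_diff (lerD (lerD (ler_wpM2l py IH1) (ler_wpM2l qy IH0))
                      (ler_wpM2l (mulr_ge0 pa (ltW qb)) Hy)); ring.
Qed.

(** [opt G] is at most the value of starting with the y that is optimal after x_b = 1. So
    [exchange_step] applies, and both outcomes of y have a smaller support. *)
Lemma exchange_ineq G a b : a != b -> same_terms G a b -> ratio a <= ratio b ->
  (1 - p a) * (opt G - opt (fix1 b G)) <= exchange_bound G a b.
Proof.
move=> ab + rab; elim: {G}_.+1 {-2}G (ltnSn #|support G|) => // d IH G.
rewrite ltnS => cG Gab.
(* In the degenerate cases all differences of values vanish, and only this part of the bound is
   left. *)
have slack : 0 <= p a * (c b * (1 - p a) - c a * (1 - p b)).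
  by rewrite mulr_ge0 ?p_ge0 // subr_ge0 -le_ratio.
have [G0|G0] := boolP (set0 \in G).
  by rewrite /exchange_bound !opt_set0 ?set0_fix1 // !subrr !mulr0 addr0.
have [bG|bG] := boolP (b \in support G); last first.
  have aG : a \notin support G by rewrite (same_terms_support Gab).
  by rewrite /exchange_bound (fix1_out aG) (fix1_out bG) !subrr !mulr0 addr0.
have Gb0 : set0 \notin fix1 b G.
  by apply: set0_notin_fix1 (same_terms_sym Gab) G0; rewrite eq_sym.
have GbN : fix1 b G != [::] by case: (G) bG => //; rewrite inE.
have [y yGb [Ey _]] := opt_supp Gb0 GbN.
move: yGb; rewrite support_fix1 !inE => /andP[yb yG].
have yG' : y \in support G by rewrite inE.
suff H : (1 - p a) * (test_opt G y - opt (fix1 b G)) <= exchange_bound G a b.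
  by apply: le_trans H; rewrite ler_wpM2l ?q_ge0 // lerB // opt_le_test.
apply: exchange_step => // ya _ [->|->]; apply: IH.
- exact: leq_trans (card_fix1_lt yG') cG.
- by rewrite same_terms_fix1 // eq_sym.
- exact: leq_trans (card_fix0_lt yG') cG.
- exact: same_terms_fix0.
Qed.

(* Postponing x_b: an optimal first test after x_b = 1 is at least as good now
   as x_b itself, since it was then not worse than testing x_a. *)
Lemma exchange G a b y : a != b -> same_terms G a b -> ratio a <= ratio b ->
  y != b -> opt (fix1 b G) = test_opt (fix1 b G) y -> test_opt G y <= test_opt G b.
Proof.
move=> ab Gab rab yb Ey.
have H : (1 - p a) * (test_opt G y - opt (fix1 b G)) <= exchange_bound G a b.
  apply: exchange_step => // ya _ [->|->]; apply: exchange_ineq => //.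
    by rewrite same_terms_fix1 // eq_sym.
  exact: same_terms_fix0.
have := opt_le_test (fix1 b G) a; rewrite /test_opt /test_value.
have Gba := same_terms_sym Gab.
have -> : fix0 a (fix1 b G) = fix0 b G.
  by rewrite -fix10C 1?eq_sym // fix1_out (same_terms_eq_fix0 Gab)
    ?(notin_support_fix0 Gba) // -(same_terms_eq_fix0 Gab) notin_support_fix0.
move: H; rewrite /exchange_bound (fix11C _ a b) -/(test_value _ _ _) -/(test_opt _ _).
have := q_gt0 a; have := q_gt0 b => qb qa H1 H2.
have H3 : (1 - p a) * (c a * (1 - p b)) <= (1 - p a) * (c b * (1 - p a)).
  by rewrite ler_pM2l // -le_ratio.
(* Times [1 - p a], the goal is the sum of the exchange bound, [1 - p b] times the bound of
   [opt (fix1 b G)] by testing a, and the ratio order. *)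
rewrite -(ler_pM2l qa).
apply: ler_diff (lerD (lerD H1 (ler_wpM2l (ltW qb) H2)) H3); ring.
Qed.

(** Breaking ties by index gives a strict total order, so members of a class get distinct ranks. The
    form uses only the comparisons that programs have. *)
Definition before i j :=
  (ratio i <= ratio j) && ~~ ((ratio j <= ratio i) && (j <= i)%N).

Definition undominated G y := forall z, same_terms G z y -> ~~ before z y.

Lemma before_trans i j l : before i j -> before j l -> before i l.
Proof.
rewrite /before => /andP[ij Nij] /andP[jl Njl].
rewrite (le_trans ij jl) /=; apply/negP => /andP[li lei].
move: Nij Njl; rewrite (le_trans jl li) (le_trans li ij) /= -!ltnNge; lia.
Qed.

Lemma before_irr i : before i i = false.
Proof. by rewrite /before lexx leqnn. Qed.

Lemma before_total i j : i != j -> before i j || before j i.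
Proof.
move=> ij; have : (i < j)%N || (j < i)%N by rewrite -neq_ltn.
rewrite /before; have := le_total (ratio i) (ratio j).
by case: (ratio i <= ratio j); case: (ratio j <= ratio i); rewrite //= -!ltnNge.
Qed.

(** If an optimal b is preceded by some a in its class, take an undominated optimal y after x_b = 1;
    by [exchange] it is optimal now as well. Only b could newly dominate y, but then a, preceding b,
    would already have dominated it. *)
Lemma undominated_opt G : set0 \notin G -> G != [::] ->
  exists y, [/\ y \in support G, undominated G y & opt G = test_opt G y].
Proof.
elim: {G}_.+1 {-2}G (ltnSn #|support G|) => // d IH G.
rewrite ltnS => cG G0 GN; have [b bG [Eb _]] := opt_supp G0 GN.
have [/existsP[a /andP[Gab ab]]|/existsPn Hb] :=
  boolP [exists a, same_terms G a b && before a b]; last first.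
  by exists b; split=> // z Gz; have := Hb z; rewrite Gz.
have neq_ab : a != b by apply/eqP => E; rewrite E before_irr in ab.
have Gba := same_terms_sym Gab.
have Gb0 : set0 \notin fix1 b G by apply: set0_notin_fix1 Gba G0; rewrite eq_sym.
have GbN : fix1 b G != [::] by case: (G) GN.
have [y [yGb yU Ey]] := IH _ (leq_trans (card_fix1_lt bG) cG) Gb0 GbN.
move: yGb; rewrite support_fix1 !inE => /andP[yb yG].
have rab : ratio a <= ratio b by case/andP: ab.
exists y; split; first by rewrite inE.
- move=> z Gzy; have [Ez|zb] := eqVneq z b; last by apply: yU; rewrite same_terms_fix1.
  apply/negP => by_; rewrite Ez in Gzy by_.
  have := yU a; rewrite same_terms_fix1 // (same_terms_trans Gab Gzy) => /(_ isT).
  by rewrite (before_trans ab by_).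
- apply/eqP; rewrite eq_le opt_le_test /= Eb.
  exact: exchange neq_ab Gab rab yb Ey.
Qed.

End Opt.

(** * Decision trees *)

Section Trees.
Variables (R : realFieldType) (n : nat) (p c : 'I_n -> R).
Hypothesis p01 : forall i, 0 < p i < 1.
Hypothesis c_ge0 : forall i, 0 <= c i.
Implicit Types (G : mdnf n) (i j : 'I_n) (x : assignment n) (t : dtree n).

Definition set_var x i b : assignment n := [ffun j => if j == i then b else x j].

Lemma mdnf_eval_fix1 G i x : mdnf_eval (fix1 i G) x = mdnf_eval G (set_var x i true).
Proof.
rewrite /mdnf_eval has_map; apply: eq_has => A /=; apply: eq_forallb => j.
by rewrite ffunE !inE; case: eqP => //=; rewrite implybT.
Qed.

Lemma mdnf_eval_fix0 G i x : mdnf_eval (fix0 i G) x = mdnf_eval G (set_var x i false).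
Proof.
rewrite /mdnf_eval /fix0 has_filter -filter_predI -has_filter; apply: eq_has => A /=.
have [iA|iA] := boolP (i \in A).
  rewrite andbF; apply/esym/negP=> /forallP/(_ i).
  by rewrite iA ffunE eqxx.
rewrite andbT; apply: eq_forallb => j; rewrite ffunE; case: eqP => // ->.
by rewrite (negbTE iA).
Qed.

Lemma mdnf_eval_set0 G x : set0 \in G -> mdnf_eval G x.
Proof. by move=> G0; apply/hasP; exists set0 => //; apply/forallP=> i; rewrite inE. Qed.

(** By monotonicity two inputs decide: all-false satisfies only the empty term, all-true satisfies
    every term. *)
Lemma mdnf_eval_const G b : (forall x, mdnf_eval G x = b) ->
  if b then set0 \in G else G == [::].
Proof.
case: b => H.
  have := H [ffun=> false] => /hasP[A AG /forallP HA].
  suff <- : A = set0 by [].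
  apply/setP=> i; rewrite inE; apply/negP=> iA.
  by have := HA i; rewrite iA ffunE.
case: G H => [//|A G] /(_ [ffun=> true]).
by rewrite /mdnf_eval /= => /norP[/negP[]]; apply/forallP=> i; rewrite ffunE implybT.
Qed.

Definition expect (h : assignment n -> R) : R := \sum_x prod_prob p x * h x.

Lemma eq_expect h h' : h =1 h' -> expect h = expect h'.
Proof. by move=> E; apply: eq_bigr => x _; rewrite E. Qed.

Lemma expect_const a : expect (fun=> a) = a.
Proof.
rewrite /expect -mulr_suml /prod_prob.
pose w i (b : bool) := if b then p i else 1 - p i.
rewrite -(bigA_distr_bigA w) big1 ?mul1r // => i _.
by rewrite big_bool /w /= addrC subrK.
Qed.

Lemma expectD h h' : expect (fun x => h x + h' x) = expect h + expect h'.
Proof. by rewrite /expect -big_split; apply: eq_bigr => x _; rewrite /= mulrDr. Qed.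

(** Flipping x_i pairs the assignments. The weights of a pair add up to the weight of the other
    variables, and [h (set_var x i b)] is the same on both. *)
Lemma expect_fixed i b h :
  (if b then p i else 1 - p i) * expect (fun x => h (set_var x i b))
  = \sum_(x : assignment n | x i == b) prod_prob p x * h x.
Proof.
pose w (b' : bool) := if b' then p i else 1 - p i.
pose rest x := \prod_(j < n | j != i) (if x j then p j else 1 - p j).
have PE x : prod_prob p x = w (x i) * rest x by rewrite /prod_prob (bigD1 i).
pose flip x := set_var x i (~~ x i).
have flipK : involutive flip.
  move=> x; apply/ffunP=> j; rewrite !ffunE eqxx negbK.
  by case: eqP => [->|].
have fixE x : x i = b -> set_var x i b = x.
  by move=> E; apply/ffunP=> j; rewrite ffunE; case: eqP => [->|].
rewrite -/(w b) /expect (bigID (fun x => x i == b)) /=.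
rewrite [X in _ + X](reindex_inj (inv_inj flipK)) /=.
rewrite [X in _ + X](eq_bigl (fun x => x i == b)); last first.
  by move=> x; rewrite ffunE eqxx; case: (x i) (b) => [] [].
rewrite -big_split /= big_distrr /=; apply: eq_bigr => x /eqP xi.
have -> : set_var (flip x) i b = set_var x i b.
  by apply/ffunP=> j; rewrite !ffunE; case: eqP.
have rE : rest (flip x) = rest x.
  by apply: eq_bigr => j /negbTE ji; rewrite ffunE ji.
rewrite fixE // -mulrDl !PE rE ffunE eqxx xi -mulrDl.
have -> : w b + w (~~ b) = 1 by rewrite /w; case: (b) => /=; rewrite ?subrK // addrC subrK.
by rewrite mul1r mulrA.
Qed.

Lemma expect_split i h :
  expect h = p i * expect (fun x => h (set_var x i true))
             + (1 - p i) * expect (fun x => h (set_var x i false)).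
Proof.
rewrite (expect_fixed i true) (expect_fixed i false) /expect (bigID (fun x => x i)) /=.
by congr (_ + _); apply: eq_bigl => x; case: (x i).
Qed.

Definition override (z : 'I_n -> option bool) x : assignment n :=
  [ffun j => odflt (x j) (z j)].

(** A strategy may repeat a test, so [z] records earlier outcomes. A repeated test only adds a
    nonnegative cost; a new one is handled by [opt_le_test]. *)
Lemma opt_le_expect t (z : 'I_n -> option bool) G :
  (forall x, dt_eval t (override z x) = mdnf_eval G x) ->
  opt p c G <= expect (fun x => dt_cost c t (override z x)).
Proof.
elim: t z G => [b|i t0 IH0 t1 IH1] z G /= H.
  rewrite expect_const; have := mdnf_eval_const (fun x => esym (H x)).
  by case: (b) => [/opt_set0 ->|/eqP ->]; rewrite ?opt_nil.
rewrite expectD expect_const; case zi: (z i) => [b|].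
  have E x : override z x i = b by rewrite ffunE zi.
  have Ec : expect (fun x => if override z x i then dt_cost c t1 (override z x)
                    else dt_cost c t0 (override z x))
     = if b then expect (fun x => dt_cost c t1 (override z x))
       else expect (fun x => dt_cost c t0 (override z x)).
    by case: (b) E => E; apply: eq_expect => x; rewrite E.
  rewrite Ec -[X in X <= _]add0r lerD ?c_ge0 //; case: (b) E => E.
    by apply: IH1 => x; rewrite -H E.
  by apply: IH0 => x; rewrite -H E.
pose zb b j := if j == i then Some b else z j.
have E b x : override z (set_var x i b) = override (zb b) x.
  by apply/ffunP=> j; rewrite !ffunE /zb; case: eqP => [->|] //; rewrite zi.
have Ei b x : override (zb b) x i = b by rewrite ffunE /zb eqxx.
apply: le_trans (opt_le_test p01 c_ge0 G i) _; rewrite lerD2l.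
rewrite (expect_split i); under eq_expect do rewrite E Ei.
under [X in _ <= _ + _ * X]eq_expect do rewrite E Ei.
apply: lerD; apply: ler_wpM2l; rewrite ?p_ge0 ?q_ge0 //.
  apply: IH1 => x; rewrite mdnf_eval_fix1 -H E.
  by rewrite Ei.
apply: IH0 => x; rewrite mdnf_eval_fix0 -H E.
by rewrite Ei.
Qed.

Lemma opt_le_cost t G : dt_computes t G -> opt p c G <= expected_cost p c t.
Proof.
move=> H; have E x : override (fun=> None) x = x by apply/ffunP=> j; rewrite ffunE.
apply: le_trans (opt_le_expect (t := t) (z := fun=> None) _) _.
  by move=> x; rewrite E.
by under eq_expect do rewrite E.
Qed.

(* That t does not test the variables in S is expressed through its cost. *)
Definition opt_tree G (S : {set 'I_n}) t :=
  [/\ dt_computes t G, expected_cost p c t = opt p c G &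
      {in S, forall i x b, dt_cost c t (set_var x i b) = dt_cost c t x}].

Lemma opt_tree_strategy G S t : opt_tree G S t -> optimal_strategy p c G t.
Proof. by case=> H E _; split=> // t' /opt_le_cost; rewrite E. Qed.

Lemma opt_tree_true G S : set0 \in G -> opt_tree G S (Leaf true).
Proof.
move=> G0; split=> //; first by move=> x; rewrite mdnf_eval_set0.
by rewrite opt_set0 // -[RHS]expect_const.
Qed.

Lemma opt_tree_false S : opt_tree [::] S (Leaf false).
Proof. by split=> //; rewrite opt_nil -[RHS]expect_const. Qed.

(** The costs of the subtrees do not depend on x_i, as [S0] and [S1] contain i, so conditioning on
    x_i leaves their expectations unchanged. *)
Lemma opt_tree_test G (S S0 S1 : {set 'I_n}) i t0 t1 :
  i \notin S -> i |: S \subset S0 -> i |: S \subset S1 ->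
  opt_tree (fix0 i G) S0 t0 -> opt_tree (fix1 i G) S1 t1 ->
  opt p c G = test_opt p c G i -> opt_tree G S (Test i t0 t1).
Proof.
move=> iS /subsetP S0S /subsetP S1S [C0 E0 I0] [C1 E1 I1] EG.
have fixE x : set_var x i (x i) = x.
  by apply/ffunP=> j; rewrite ffunE; case: eqP => [->|].
split.
- move=> x /=; rewrite C0 C1 mdnf_eval_fix0 mdnf_eval_fix1.
  by case: (boolP (x i)) => [|/negbTE] E; rewrite -E fixE.
- rewrite EG -[LHS]/(expect (dt_cost c (Test i t0 t1))) /= expectD expect_const.
  rewrite /test_opt /test_value (expect_split i).
  congr (_ + (_ * _ + _ * _)).
    rewrite -E1; apply: eq_expect => x; rewrite ffunE eqxx.
    by rewrite I1 // S1S // !inE eqxx.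
  rewrite -E0; apply: eq_expect => x; rewrite ffunE eqxx.
  by rewrite I0 // S0S // !inE eqxx.
move=> j jS x b /=; have ij : (i == j) = false by apply: contraNF iS => /eqP ->.
by rewrite ffunE ij I0 ?I1 // ?S0S ?S1S // !inE jS orbT.
Qed.

End Trees.

(** * Reasoning about programs *)

Definition nset (R : Type) (s : store R) a j v : store R :=
  Store (mem_set (nmem s) a j v) (rmem s).
Definition rset (R : Type) (s : store R) a j v : store R :=
  Store (nmem s) (mem_set (rmem s) a j v).

(* Bounds the running time when every loop is iterated at most u times. *)
Fixpoint time_bound (P : cmd) : {poly nat} :=
  match P with
  | Skip => 1
  | NSet _ e1 e2 => ((nsize e1 + nsize e2).+1)%:P
  | RSet _ e1 e2 => ((nsize e1 + rsize e2).+1)%:P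
  | Seq P1 P2 => time_bound P1 + time_bound P2
  | If b P1 P2 => (bsize b).+1%:P + (time_bound P1 + time_bound P2)
  | While b P => (bsize b).+1%:P + 'X * ((bsize b).+1%:P + time_bound P)
  end.

Fixpoint nat_writes (P : cmd) : seq nat :=
  match P with
  | NSet a _ _ => [:: a]
  | Seq P1 P2 | If _ P1 P2 => nat_writes P1 ++ nat_writes P2
  | While _ P => nat_writes P
  | _ => [::]
  end.

Fixpoint field_writes (P : cmd) : seq nat :=
  match P with
  | RSet a _ _ => [:: a]
  | Seq P1 P2 | If _ P1 P2 => field_writes P1 ++ field_writes P2
  | While _ P => field_writes P
  | _ => [::]
  end.

(* The counter is cell 0 of the array x, the fixed number of rounds cell 1. *)
Definition For (x : nat) (e : nexp) (P : cmd) : cmd :=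
  Seq (NSet x (NConst 1) e) (Seq (NSet x (NConst 0) (NConst 0))
    (While (BNot (BLeN (NGet x (NConst 1)) (NGet x (NConst 0))))
       (Seq P (NSet x (NConst 0) (NAdd (NGet x (NConst 0)) (NConst 1)))))).

Section ProgramLogic.
Variable R : realFieldType.
Implicit Types (s : store R) (P : cmd) (Q : store R -> Prop).

Definition unchanged P s s' :=
  (forall a, a \notin nat_writes P -> nmem s' a = nmem s a) /\
  (forall a, a \notin field_writes P -> rmem s' a = rmem s a).

Lemma unchanged_trans P s1 s2 s3 :
  unchanged P s1 s2 -> unchanged P s2 s3 -> unchanged P s1 s3.
Proof.
by move=> [H1 K1] [H2 K2]; split=> a Ha; rewrite ?H2 ?K2 ?H1 ?K1.
Qed.

Lemma unchanged_sub P P' s s' :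
  {subset nat_writes P <= nat_writes P'} ->
  {subset field_writes P <= field_writes P'} ->
  unchanged P s s' -> unchanged P' s s'.
Proof.
by move=> HN HF [H K]; split=> a Ha; [apply: H | apply: K]; apply: contra Ha;
  [apply: HN | apply: HF].
Qed.

Lemma mem_set_neq (A : Type) (m : memory A) a j v a' :
  a' != a -> mem_set m a j v a' = m a'.
Proof. by rewrite /mem_set => /negbTE ->. Qed.

Lemma exec_unchanged P s t s' : exec P s t s' -> unchanged P s s'.
Proof.
elim=> {P s t s'} //=.
- by move=> a e1 e2 s; split=> // a'; rewrite inE => H; apply: mem_set_neq.
- by move=> a e1 e2 s; split=> // a'; rewrite inE => H; apply: mem_set_neq.
- move=> P1 P2 s s1 s2 t1 t2 _ H1 _ H2.
  apply: (unchanged_trans (s2 := s1));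
    [apply: unchanged_sub H1 | apply: unchanged_sub H2] => a /= H;
    by rewrite mem_cat H ?orbT.
- move=> b P1 P2 s s1 t _; case: ifP => _; apply: unchanged_sub => a /= H;
    by rewrite mem_cat H ?orbT.
- by move=> b P s s1 s2 t1 t2 _ _ H1 _ H2; apply: unchanged_trans H1 H2.
Qed.

Definition runs u P s Q :=
  exists t s', [/\ exec P s t s', (t <= (time_bound P).[u])%N & Q s'].

Lemma runs_frame u P s Q :
  runs u P s (fun s' => unchanged P s s' -> Q s') -> runs u P s Q.
Proof.
by move=> [t [s' [E T HQ]]]; exists t, s'; split=> //; apply/HQ/exec_unchanged/E.
Qed.

Lemma runs_weaken u P s Q Q' : runs u P s Q -> (forall s', Q s' -> Q' s') ->
  runs u P s Q'.
Proof. by move=> [t [s' [E T HQ]]] H; exists t, s'; split=> //; apply: H. Qed.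

Lemma runs_post u P s Q Q' : runs u P s Q ->
  (forall s', unchanged P s s' -> Q s' -> Q' s') -> runs u P s Q'.
Proof.
move=> H HQ; apply: runs_frame; apply: runs_weaken H _ => s' Qs' U.
exact: HQ.
Qed.

Lemma runs_skip u s Q : Q s -> runs u Skip s Q.
Proof. by move=> HQ; exists 1%N, s; split=> //=; [constructor | rewrite hornerC]. Qed.

Lemma runs_nset u a e1 e2 s Q :
  Q (nset s a (neval s e1) (neval s e2)) -> runs u (NSet a e1 e2) s Q.
Proof. by move=> HQ; do 2!eexists; split; [constructor | rewrite /= hornerC |]. Qed.

Lemma runs_rset u a e1 e2 s Q :
  Q (rset s a (neval s e1) (reval s e2)) -> runs u (RSet a e1 e2) s Q.
Proof. by move=> HQ; do 2!eexists; split; [constructor | rewrite /= hornerC |]. Qed.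

Lemma runs_seq u P1 P2 s Q :
  runs u P1 s (fun s1 => runs u P2 s1 Q) -> runs u (Seq P1 P2) s Q.
Proof.
move=> [t1 [s1 [E1 T1 [t2 [s2 [E2 T2 HQ]]]]]]; exists (t1 + t2)%N, s2; split=> //.
  exact: ExecSeq E1 E2.
by rewrite /= hornerD leq_add.
Qed.

Lemma runs_if u b P1 P2 s Q :
  runs u (if beval s b then P1 else P2) s Q -> runs u (If b P1 P2) s Q.
Proof.
move=> [t [s' [E T HQ]]]; exists (bsize b + t).+1, s'; split=> //.
  exact: ExecIf.
rewrite /= hornerD hornerC hornerD !natrDE addSn ltnS leq_add2l (leq_trans T) //.
by case: (beval s b); [apply: leq_addr | apply: leq_addl].
Qed.

(** The invariant has to survive writes to the array [x], which holds the counter and the bound.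
    Since the body does not write to [x], the number of rounds is fixed on entry. *)
Lemma runs_for u x e P s (I : nat -> store R -> Prop) Q :
  (neval s e <= u)%N -> x \notin nat_writes P ->
  (forall i s' j v, I i s' -> I i (nset s' x j v)) ->
  I 0 s ->
  (forall i s', (i < neval s e)%N -> nmem s' x 0 = i ->
     unchanged (For x e P) s s' -> I i s' -> runs u P s' (I i.+1)) ->
  (forall s', unchanged (For x e P) s s' -> I (neval s e) s' -> Q s') ->
  runs u (For x e P) s Q.
Proof.
move=> Nu xP Ix I0 IS HQ; apply: runs_frame.
set N := neval s e in Nu IS HQ *.
apply: runs_seq; apply: runs_nset => /=.
apply: runs_seq; apply: runs_nset => /=.
set s0 := nset (nset s x 1 N) x 0 0.
pose P' := Seq P (NSet x (NConst 0) (NAdd (NGet x (NConst 0)) (NConst 1))).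
pose b := BNot (BLeN (NGet x (NConst 1)) (NGet x (NConst 0))).
pose W := While b P'; rewrite -/b -/P' -/W.
have U0 : unchanged (For x e P) s s0.
  by split=> // a /=; rewrite inE negb_or => /andP[ax _]; rewrite !mem_set_neq.
have loop d i s' : (i + d = N)%N -> unchanged (For x e P) s s' ->
    nmem s' x 0 = i -> nmem s' x 1 = N -> I i s' ->
    exists t s'', [/\ exec W s' t s'',
      (t <= (bsize b).+1 + d * ((bsize b).+1 + (time_bound P').[u]))%N & I N s''].
  elim: d i s' => [|d IH] i s' Ed Us' E0 E1 Is'.
    exists (bsize b).+1, s'; split; last by rewrite -Ed addn0.
      by apply: ExecWhileStop; rewrite /= E0 E1 -Ed addn0 leqnn.
    by rewrite mul0n addn0.
  have iN : (i < N)%N by rewrite -Ed addnS ltnS leq_addr.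
  have [t1 [s1 [X1 T1 I1]]] := IS i s' iN E0 Us' Is'.
  have U1 := exec_unchanged X1.
  pose s2 := nset s1 x 0 i.+1.
  (* 6 is the cost of incrementing the counter. *)
  have X2 : exec P' s' (t1 + 6) s2.
    apply: (ExecSeq X1); have -> : s2 = nset s1 x (neval s1 (NConst 0))
        (neval s1 (NAdd (NGet x (NConst 0)) (NConst 1))).
      by rewrite /= U1.1 // E0 addn1.
    exact: ExecNSet.
  have [] := IH i.+1 s2.
  - by rewrite addSnnS.
  - apply: unchanged_trans Us' _; apply: (unchanged_trans (s2 := s1)).
      by apply: unchanged_sub U1 => a /= aP; rewrite ?inE ?mem_cat aP ?orbT.
    by split=> // a /=; rewrite inE negb_or => /andP[ax _]; rewrite mem_set_neq.
  - by rewrite /= /mem_set !eqxx.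
  - by rewrite /= /mem_set eqxx /= U1.1.
  - exact: Ix.
  move=> t [s'' [X3 T3 I3]]; exists (bsize b + (t1 + 6) + t).+1, s''; split=> //.
    by apply: ExecWhileStep X2 X3; rewrite /= E0 E1 -ltnNge.
  have -> : (time_bound P').[u] = ((time_bound P).[u] + 6)%N.
    by rewrite /= hornerD hornerC natrDE.
  move: T1 T3; rewrite /= hornerD hornerC !natrDE; lia.
have [] := loop N 0 s0 (add0n N) U0.
- by rewrite /= /mem_set !eqxx.
- by rewrite /= /mem_set !eqxx.
- by apply/Ix/Ix.
move=> t [s' [X T IN]]; exists t, s'; split=> //; last first.
  by move=> U; apply: HQ.
apply: leq_trans T _.
rewrite -[time_bound W]/((bsize b).+1%:P + 'X * ((bsize b).+1%:P + time_bound P')).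
move: (time_bound P') => B; rewrite hornerD hornerC hornerM hornerX hornerD hornerC.
by rewrite !natrDE !natrME leq_add2l leq_mul2r Nu orbT.
Qed.

End ProgramLogic.

(** * The states of the dynamic program *)

Section Digits.
Variable M : nat.

Definition digit e C := ((e %/ M ^ C) %% M)%N.

Hypothesis M_gt0 : (0 < M)%N.

(** The digit at [C] absorbs [d] without a carry, so nothing reaches the higher digits. *)
Lemma divn_add_high e d C C' : (C < C')%N -> (digit e C + d < M)%N ->
  ((e + d * M ^ C) %/ M ^ C' = e %/ M ^ C')%N.
Proof.
move=> CC' dM; have -> : (M ^ C' = M ^ C * (M * M ^ (C' - C.+1)))%N.
  by rewrite -expnS -expnD; congr (M ^ _)%N; lia.
rewrite !divnMA addnC divnMDl ?expn_gt0 ?M_gt0 //; congr (_ %/ _)%N.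
rewrite [in LHS](divn_eq (e %/ M ^ C) M) addnCA divnMDl //.
by rewrite [((_ + _) %/ M)%N]divn_small ?addn0 // addnC.
Qed.

Lemma digit_add e d C C' : (digit e C + d < M)%N ->
  digit (e + d * M ^ C) C' = if C' == C then (digit e C + d)%N else digit e C'.
Proof.
move=> dM; have [->|neq] := eqVneq C' C.
  rewrite /digit addnC divnMDl ?expn_gt0 ?M_gt0 // addnC -modnDml modn_small //.
rewrite /digit; have [lt|ge] := ltnP C C'; first by rewrite divn_add_high.
have {neq}lt : (C' < C)%N by rewrite ltn_neqAle neq.
have -> : (d * M ^ C = d * M ^ (C - C'.+1) * M * M ^ C')%N.
  by rewrite -!mulnA -expnS -expnD; congr (_ * M ^ _)%N; lia.
by rewrite addnC divnMDl ?expn_gt0 ?M_gt0 // modnMDl.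
Qed.

Lemma ltn_add_digit e d C L : (e < M ^ L)%N -> (C < L)%N -> (digit e C + d < M)%N ->
  (e + d * M ^ C < M ^ L)%N.
Proof.
have ML : (0 < M ^ L)%N by rewrite expn_gt0 M_gt0.
move=> eL CL dM; rewrite -[X in (_ < X)%N]mul1n -ltn_divLR // divn_add_high //.
by rewrite divn_small.
Qed.

End Digits.

(** * Residual formulas encoded by their digits *)

Section States.
Variables (R : realFieldType) (n : nat) (p c : 'I_n -> R) (F : mdnf n).
Hypothesis p01 : forall i, 0 < p i < 1.
Hypothesis c_ge0 : forall i, 0 <= c i.
Implicit Types (i y z : 'I_n) (e : nat).

(* The binary number whose digits tell which of the first m terms contain x_i. *)
Fixpoint class_prefix i m : nat :=
  if m is m'.+1 then
    (class_prefix i m' + class_prefix i m' + (i \in nth set0 F m'))%N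
  else 0%N.

Definition class i := class_prefix i (size F).
Definition rank i := #|[set z | (class z == class i) && before p c z i]|.

(* The digit of a state at a class is the number of variables of the class known
   to be 1, or n + 1 once a variable of the class is known to be 0. *)
Definition radix := n.+2.
Definition num_states := (radix ^ 2 ^ size F)%N.
Definition progress e i := digit radix e (class i).
Definition tested e : {set 'I_n} := [set i | (rank i < progress e i)%N].
Definition dead e : {set 'I_n} := [set i | progress e i == n.+1].
(** As n + 1 exceeds every rank, the variables of a dead class also count as tested; this removes
    nothing from the surviving terms, which avoid that class. *)
Definition residual e : mdnf n :=
  [seq A :\: tested e | A : {set 'I_n} <- F & [disjoint A & dead e]].
(** The rank counts the class members before i, so equality singles out the first untested variable
    of a class that is not dead. *)
Definition candidate e i := progress e i == rank i.
Definition succ1 e i := (e + radix ^ class i)%N.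
Definition succ0 e i := (e + (n.+1 - progress e i) * radix ^ class i)%N.

Lemma class_prefix_lt i m : (class_prefix i m < 2 ^ m)%N.
Proof.
elim: m => //= m IH; rewrite expnS; move: IH; case: (_ \in _) => /=; lia.
Qed.

Lemma class_lt i : (class i < 2 ^ size F)%N.
Proof. exact: class_prefix_lt. Qed.

Lemma class_prefix_inj i z m : class_prefix i m = class_prefix z m ->
  forall j, (j < m)%N -> (i \in nth set0 F j) = (z \in nth set0 F j).
Proof.
elim: m => //= m IH E j; rewrite ltnS leq_eqVlt => /predU1P[->|].
  by case: (i \in _) E; case: (z \in _) => //= E; exfalso; lia.
by apply: IH; move: E; case: (i \in _); case: (z \in _) => /=; lia.
Qed.

Lemma class_same_terms i z : class i = class z -> same_terms F i z.
Proof.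
move=> E; apply/same_termsP => A AF; rewrite -(nth_index set0 AF).
by apply: (class_prefix_inj E); rewrite index_mem.
Qed.

Lemma rank_lt i : (rank i < n)%N.
Proof.
rewrite -[X in (_ < X)%N](card_ord n) -cardsT; apply: proper_card.
apply/properP; split; first exact: subsetT.
by exists i; rewrite ?inE // before_irr andbF.
Qed.

Lemma rank_mono z i : class z = class i -> before p c z i -> (rank z < rank i)%N.
Proof.
move=> E zi; apply: proper_card; apply/properP; split.
  by apply/subsetP => w; rewrite !inE E => /andP[-> /before_trans ->].
by exists z; rewrite !inE E eqxx ?before_irr.
Qed.

Lemma rank_inj z i : class z = class i -> rank z = rank i -> z = i.
Proof.
move=> E Er; apply/eqP; apply: contraT => /(before_total p c)/orP[] H.
- by have := rank_mono E H; rewrite Er ltnn.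
- by have := rank_mono (esym E) H; rewrite Er ltnn.
Qed.

Lemma progress_le e i : (progress e i <= n.+1)%N.
Proof. by rewrite -ltnS ltn_mod. Qed.

Lemma progress_succ1 e i z : candidate e i ->
  progress (succ1 e i) z
  = if class z == class i then (rank i).+1 else progress e z.
Proof.
move=> /eqP E; rewrite /progress /succ1 -[X in (_ + X)%N]mul1n.
by rewrite digit_add //; rewrite -/(progress e i) E addn1 // !ltnS ltnW ?rank_lt.
Qed.

Lemma progress_succ0 e i z : candidate e i ->
  progress (succ0 e i) z = if class z == class i then n.+1 else progress e z.
Proof.
move=> /eqP E; rewrite /progress /succ0.
by rewrite digit_add // -/(progress e i) subnKC ?progress_le.
Qed.

Lemma succ1_lt e i : (e < num_states)%N -> candidate e i -> (succ1 e i < num_states)%N.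
Proof.
move=> eN /eqP E; rewrite /succ1 -[X in (_ + X)%N]mul1n.
apply: ltn_add_digit eN (class_lt i) _ => //.
by rewrite -/(progress e i) E addn1 !ltnS ltnW // rank_lt.
Qed.

Lemma succ0_lt e i : (e < num_states)%N -> (succ0 e i < num_states)%N.
Proof.
move=> eN; apply: ltn_add_digit eN (class_lt i) _ => //.
by rewrite -/(progress e i) subnKC ?progress_le.
Qed.

Lemma succ1_gt e i : (e < succ1 e i)%N.
Proof. by rewrite /succ1 -[X in (X < _)%N]addn0 ltn_add2l expn_gt0. Qed.

Lemma succ0_gt e i : candidate e i -> (e < succ0 e i)%N.
Proof.
move=> /eqP E; rewrite /succ0 -[X in (X < _)%N]addn0 ltn_add2l muln_gt0 expn_gt0.
by rewrite subn_gt0 E ltnS ltnW ?rank_lt.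
Qed.

Lemma tested_succ1 e i : candidate e i -> tested (succ1 e i) = i |: tested e.
Proof.
move=> Ci; apply/setP=> z; rewrite !inE progress_succ1 //.
case: (eqVneq (class z) (class i)) => [Ez|]; last first.
  by case: (eqVneq z i) => [->|]; rewrite ?eqxx.
have Ep : progress e z = rank i by rewrite /progress Ez; apply/eqP.
rewrite Ep ltnS leq_eqVlt; congr (_ || _).
by apply/eqP/eqP => [/(rank_inj Ez)|->].
Qed.

Lemma dead_succ1 e i : candidate e i -> dead (succ1 e i) = dead e.
Proof.
move=> Ci; apply/setP=> z; rewrite !inE progress_succ1 //.
case: (eqVneq (class z) (class i)) => // Ez.
have -> : progress e z = rank i by rewrite /progress Ez; apply/eqP.
by have := rank_lt i; case: eqP; case: eqP => //; lia.
Qed.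

Lemma dead_succ0 e i : candidate e i ->
  dead (succ0 e i) = dead e :|: [set z | class z == class i].
Proof.
move=> Ci; apply/setP=> z; rewrite !inE progress_succ0 //.
by case: ifP => _; rewrite ?eqxx ?orbT ?orbF.
Qed.

Lemma tested_succ0 e i : candidate e i ->
  tested (succ0 e i) = tested e :|: [set z | class z == class i].
Proof.
move=> Ci; apply/setP=> z; rewrite !inE progress_succ0 //.
by case: ifP => _; rewrite ?orbT ?orbF // ltnS ltnW // rank_lt.
Qed.

Lemma candidate_untested e i : candidate e i -> i \notin tested e.
Proof. by move=> /eqP E; rewrite inE E ltnn. Qed.

Lemma residual_succ1 e i : candidate e i -> residual (succ1 e i) = fix1 i (residual e).
Proof.
move=> Ci; rewrite /residual /fix1 -map_comp dead_succ1 //; apply: eq_map => A /=.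
by rewrite tested_succ1 // setDDl setUC.
Qed.

(** A term of [F] without i avoids the whole class of i. Hence killing the class drops exactly the
    terms containing i, and marking it as tested leaves the others unchanged. *)
Lemma residual_succ0 e i : candidate e i -> residual (succ0 e i) = fix0 i (residual e).
Proof.
move=> Ci; rewrite /residual /fix0 filter_map -filter_predI dead_succ0 //.
have classA (A : {set 'I_n}) : A \in F -> i \notin A ->
    [disjoint A & [set z | class z == class i]].
  move=> AF iA; rewrite disjoint_subset; apply/subsetP => z zA; rewrite !inE.
  apply: contraNN iA => /eqP/class_same_terms/same_termsP/(_ A AF) <-.
  by [].
have -> : [seq A : {set 'I_n} <- F | [disjoint A & dead e :|: [set z | class z == class i]]]
   = [seq A : {set 'I_n} <- F | (i \notin A) && [disjoint A & dead e]].
  apply: eq_in_filter => A AF; rewrite disjoints_subset setCU subsetI.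
  rewrite -!disjoints_subset andbC; congr (_ && _).
  apply/idP/idP => [|iA]; last exact: classA.
  by move=> /pred0P/(_ i) /=; rewrite !inE eqxx andbT => /negbT.
have -> : [seq A : {set 'I_n} <- F | (i \notin A) && [disjoint A & dead e]]
  = [seq x : {set 'I_n} <- F | predI (preim (fun A : {set 'I_n} => A :\: tested e)
      (fun A : {set 'I_n} => i \notin A)) (fun A => [disjoint A & dead e]) x].
  apply: eq_filter => A /=.
  by have := candidate_untested Ci; rewrite !inE => /negbTE ->.
apply/eq_in_map => A; rewrite mem_filter /= => /andP[/andP[iA _] AF].
rewrite tested_succ0 // setDUr; apply/setIidPl; apply/subsetP => z.
rewrite !inE => /andP[_ zA]; rewrite zA andbT.
move: iA; rewrite !inE; have := candidate_untested Ci; rewrite inE => -> /= iA.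
by apply: contraNN iA => /eqP/class_same_terms/same_termsP/(_ A AF) <-.
Qed.

(** Variables sharing a class of [F] with y and still untested share its residual terms as well, so
    none of them can come before y. *)
Lemma candidate_undominated e y : y \in support (residual e) ->
  undominated p c (residual e) y -> candidate e y.
Proof.
move=> /supportP[B /mapP[A]]; rewrite mem_filter => /andP[Ad AF] -> yA yU.
move: yA; rewrite !inE -leqNgt => /andP[le_y yA].
rewrite /candidate eqn_leq le_y /=.
(* Every variable before y in its class is tested, so rank y is at most the
   number of tested variables in the class. *)
set P := [set z | (class z == class y) && before p c z y].
have rP : {in P, forall z, (rank z < progress e y)%N}.
  move=> z; rewrite inE => /andP[/eqP Ez zy]; rewrite ltnNge; apply/negP => le_z.
  suff /yU : same_terms (residual e) z y by rewrite zy.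
  apply/same_termsP => B' /mapP[A']; rewrite mem_filter => /andP[_ AF'] ->.
  rewrite !inE /progress Ez -/(progress e y) -!leqNgt le_z le_y /=.
  by have /same_termsP/(_ _ AF') -> := class_same_terms Ez.
rewrite /rank -/P.
pose f z : 'I_(progress e y).+1 := inord (rank z).
have fE z : z \in P -> f z = rank z :> nat by move=> /rP H; rewrite inordK // ltnW.
rewrite -(card_in_imset (f := f)); last first.
  move=> z w zP wP /(congr1 val) /=; rewrite !fE //; apply: rank_inj.
  by move: zP wP; rewrite !inE => /andP[/eqP -> _] /andP[/eqP -> _].
(* The codomain has one spare element to make [inord] available; the ranks stay below it. *)
have /subset_leq_card/leq_trans -> // : f @: P \subset ~: [set ord_max].
  apply/subsetP => _ /imsetP[z zP ->]; rewrite !inE; apply/eqP => /(congr1 val) /=.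
  by rewrite fE // => E; have := rP _ zP; rewrite E ltnn.
by rewrite cardsC1 card_ord.
Qed.

Lemma residual0 : residual 0 = F.
Proof.
have p0 i : progress 0 i = 0%N by rewrite /progress /digit div0n mod0n.
have -> : residual 0 = [seq A : {set 'I_n} <- F | true].
  rewrite -[RHS]map_id /residual.
  have -> : [seq A : {set 'I_n} <- F | [disjoint A & dead 0]] = [seq A : {set 'I_n} <- F | true].
    apply: eq_filter => A; apply/pred0P => i /=.
    by rewrite !inE p0 andbF.
  by apply: eq_map => A; apply/setP => i; rewrite !inE p0.
by rewrite filter_predT.
Qed.

(** Some optimal test is undominated and hence a candidate, so minimizing over candidates loses
    nothing. *)
Lemma opt_candidates e i : set0 \notin residual e -> residual e != [::] ->
  candidate e i ->
  (forall z, candidate e z ->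
     test_opt p c (residual e) i <= test_opt p c (residual e) z) ->
  opt p c (residual e) = test_opt p c (residual e) i.
Proof.
move=> G0 GN Ci Hle; apply/eqP; rewrite eq_le opt_le_test //=.
have [y [ys yU ->]] := undominated_opt p01 c_ge0 G0 GN.
by apply: Hle; apply: candidate_undominated.
Qed.

Lemma candidate_exists e : set0 \notin residual e -> residual e != [::] ->
  exists i, candidate e i.
Proof.
move=> G0 GN; have [y [ys yU _]] := undominated_opt p01 c_ge0 G0 GN.
by exists y; apply: candidate_undominated.
Qed.

Definition node_correct (m : memory nat) e :=
  [\/ m arr_label e = 1%N /\ set0 \in residual e,
      m arr_label e = 0%N /\ residual e = [::] |
      exists i, [/\ m arr_label e = i.+2, candidate e i,
        m arr_child0 e = succ0 e i, m arr_child1 e = succ1 e i &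
        opt p c (residual e) = test_opt p c (residual e) i]].

(** Induction on the distance to [num_states F], which both successors shorten. Carrying [tested e]
    along guarantees that subtrees do not pay for x_i again. *)
Lemma stored_opt_tree (m : memory nat) :
  (forall e, (e < num_states)%N -> node_correct m e) ->
  forall e, (e < num_states)%N -> exists2 t : dtree n,
    stored_tree m e t & opt_tree p c (residual e) (tested e) t.
Proof.
move=> H e eN; move: {2}(num_states - e)%N (leqnn (num_states - e)) => d.
elim: d e eN => [|d IH] e eN; first by rewrite leqn0 subn_eq0 leqNgt eN.
move=> Hd; have [[El G0]|[El G0]|[i [El Ci E0 E1 Eo]]] := H e eN.
- by exists (Leaf true); [apply: StoredLeaf | apply: opt_tree_true].
- by exists (Leaf false); [apply: StoredLeaf | rewrite G0; apply: opt_tree_false].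
have [|t0 S0 O0] := IH _ (succ0_lt i eN).
  by have := succ0_gt Ci; lia.
have [|t1 S1 O1] := IH _ (succ1_lt eN Ci).
  by have := succ1_gt e i; lia.
exists (Test i t0 t1); first by apply: StoredTest; rewrite ?E0 ?E1.
rewrite residual_succ0 // in O0; rewrite residual_succ1 // in O1.
apply: opt_tree_test O0 O1 Eo.
- exact: candidate_untested.
- by rewrite tested_succ0 // setUC setUS // sub1set inE.
- by rewrite tested_succ1.
Qed.

End States.

(** * The program *)

Definition arr_radix := 7%N.
Definition arr_classes := 8%N.     (* cell 0: the number of classes *)
Definition arr_power := 9%N.
Definition arr_class := 10%N.
Definition arr_rank := 11%N.
Definition arr_digit := 12%N.
Definition arr_quotient := 13%N.   (* cell 0: dividend, cell 1: quotient *)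
Definition arr_pointer := 14%N.
Definition arr_term_alive := 15%N.
Definition arr_term_full := 16%N.
Definition arr_alive := 17%N.
Definition arr_full := 18%N.
Definition arr_state := 19%N.
Definition arr_address := 20%N.
Definition counter1 := 21%N.
Definition counter2 := 22%N.
Definition counter3 := 23%N.
Definition arr_value := 2%N.       (* field array *)
Definition arr_temp := 3%N.        (* field array *)

Definition Var a := NGet a (NConst 0).
Definition SetVar a e := NSet a (NConst 0) e.
Definition BEqN e1 e2 := BAnd (BLeN e1 e2) (BLeN e2 e1).
Definition NVars := Var arr_nvars.
Definition Class e := NGet arr_class e.
Definition Digit e := NGet arr_digit (Class e).
Definition Ratio e := RDiv (RGet arr_cost e) (RSub ROne (RGet arr_prob e)).

Definition init_radix :=
  Seq (SetVar arr_radix (NAdd NVars (NConst 2)))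
  (Seq (SetVar arr_classes (NConst 1))
  (For counter1 (Var arr_nterms)
    (SetVar arr_classes (NAdd (Var arr_classes) (Var arr_classes))))).

(** Each power is the sum of [radix] copies of the previous one. *)
Definition init_power :=
  let i := Var counter1 in
  let i1 := NAdd i (NConst 1) in
  Seq (NSet arr_power (NConst 0) (NConst 1))
  (For counter1 (Var arr_classes)
    (Seq (NSet arr_power i1 (NConst 0))
    (For counter2 (Var arr_radix)
      (NSet arr_power i1 (NAdd (NGet arr_power i1) (NGet arr_power i)))))).

Definition init_class :=
  let i := Var counter1 in
  For counter1 NVars
    (Seq (NSet arr_class i (NConst 0))
    (Seq (SetVar arr_pointer i)
    (For counter2 (Var arr_nterms)
      (Seq (NSet arr_class i
             (NAdd (NAdd (Class i) (Class i)) (NGet arr_formula (Var arr_pointer))))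
      (SetVar arr_pointer (NAdd (Var arr_pointer) NVars)))))).

Definition init_rank :=
  let i := Var counter1 in
  let z := Var counter2 in
  For counter1 NVars
    (Seq (NSet arr_rank i (NConst 0))
    (For counter2 NVars
      (If (BAnd (BEqN (Class z) (Class i))
             (BAnd (BLeR (Ratio z) (Ratio i))
                (BNot (BAnd (BLeR (Ratio i) (Ratio z)) (BLeN i z)))))
         (NSet arr_rank i (NAdd (NGet arr_rank i) (NConst 1)))
         Skip))).

(** Division with remainder by counting up to the dividend: the digit is reset on reaching the
    radix, and each reset increments the quotient. *)
Definition decode_state :=
  let C := Var counter2 in
  let q := NGet arr_quotient (NConst 1) in
  Seq (SetVar arr_quotient (Var arr_state))
  (For counter2 (Var arr_classes)
    (Seq (NSet arr_digit C (NConst 0))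
    (Seq (NSet arr_quotient (NConst 1) (NConst 0))
    (Seq (For counter3 (Var arr_quotient)
           (Seq (NSet arr_digit C (NAdd (NGet arr_digit C) (NConst 1)))
           (If (BLeN (Var arr_radix) (NGet arr_digit C))
              (Seq (NSet arr_digit C (NConst 0))
                   (NSet arr_quotient (NConst 1) (NAdd q (NConst 1))))
              Skip)))
    (SetVar arr_quotient q))))).

Definition scan_term :=
  let i := Var counter3 in
  For counter3 NVars
    (Seq (If (BLeN (NConst 1) (NGet arr_formula (Var arr_pointer)))
       (Seq (If (BLeN (NSub (Var arr_radix) (NConst 1)) (Digit i))
               (SetVar arr_term_alive (NConst 0)) Skip)
            (If (BLeN (Digit i) (NGet arr_rank i))
               (SetVar arr_term_full (NConst 0)) Skip))
       Skip)
    (SetVar arr_pointer (NAdd (Var arr_pointer) (NConst 1)))).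

Definition scan_formula :=
  Seq (SetVar arr_alive (NConst 0))
  (Seq (SetVar arr_full (NConst 0))
  (Seq (SetVar arr_pointer (NConst 0))
  (For counter2 (Var arr_nterms)
    (Seq (SetVar arr_term_alive (NConst 1))
    (Seq (SetVar arr_term_full (NConst 1))
    (Seq scan_term
    (If (BLeN (NConst 1) (Var arr_term_alive))
       (Seq (SetVar arr_alive (NConst 1))
            (If (BLeN (NConst 1) (Var arr_term_full))
               (SetVar arr_full (NConst 1)) Skip))
       Skip))))))).

(** Label 0 means that no candidate has been met yet, since labels of tests are at least 2; the
    first candidate is then accepted whatever its value. *)
Definition try_candidate :=
  let e := Var arr_state in
  let i := Var counter2 in
  let e0 := Var arr_address in
  let e1 := NAdd e (NGet arr_power (Class i)) in
  If (BEqN (Digit i) (NGet arr_rank i))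
    (Seq (SetVar arr_address e)
    (Seq (For counter3 (NSub (NSub (Var arr_radix) (NConst 1)) (Digit i))
           (SetVar arr_address (NAdd e0 (NGet arr_power (Class i)))))
    (Seq (RSet arr_temp (NConst 0)
           (RAdd (RGet arr_cost i)
             (RAdd (RMul (RGet arr_prob i) (RGet arr_value e1))
                   (RMul (RSub ROne (RGet arr_prob i)) (RGet arr_value e0)))))
    (If (BAnd (BLeN (NConst 1) (NGet arr_label e))
              (BLeR (RGet arr_value e) (RGet arr_temp (NConst 0))))
       Skip
       (Seq (NSet arr_label e (NAdd i (NConst 2)))
       (Seq (NSet arr_child0 e e0)
       (Seq (NSet arr_child1 e e1)
            (RSet arr_value e (RGet arr_temp (NConst 0))))))))))
    Skip.

Definition make_node :=
  let e := Var arr_state in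
  Seq (RSet arr_value e RZero)
  (If (BLeN (NConst 1) (Var arr_full))
     (NSet arr_label e (NConst 1))
     (Seq (NSet arr_label e (NConst 0))
     (If (BLeN (NConst 1) (Var arr_alive)) (For counter2 NVars try_candidate) Skip))).

Definition fill_table :=
  let N := NGet arr_power (Var arr_classes) in
  For counter1 N
    (Seq (SetVar arr_state (NSub (NSub N (NConst 1)) (Var counter1)))
    (Seq decode_state (Seq scan_formula make_node))).

Definition dnf_program :=
  Seq init_radix (Seq init_power (Seq init_class (Seq init_rank fill_table))).

(** * Correctness and running time of the program *)

Section Correctness.
Variables (R : realFieldType) (n : nat) (p c : 'I_n -> R) (F : mdnf n) (u : nat).
Hypothesis p01 : forall i, 0 < p i < 1.
Hypothesis c_ge0 : forall i, 0 <= c i.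
Hypothesis u_ge : (num_states F <= u)%N.
Implicit Types (s : store R) (y z : 'I_n) (e C : nat).

Lemma classes_le : (2 ^ size F <= u)%N.
Proof. by apply: leq_trans u_ge; apply/ltnW/ltn_expl. Qed.

Lemma terms_le : (size F <= u)%N.
Proof. by apply: leq_trans classes_le; apply/ltnW/ltn_expl. Qed.

Lemma radix_le : (radix n <= u)%N.
Proof.
apply: leq_trans u_ge; rewrite /num_states -[X in (X <= _)%N]expn1 leq_exp2l //.
by rewrite expn_gt0.
Qed.

Lemma nvars_le : (n <= u)%N.
Proof. by apply: leq_trans radix_le; rewrite /radix; lia. Qed.

Record has_input s : Prop := HasInput {
  input_n : nmem s arr_nvars 0 = n;
  input_m : nmem s arr_nterms 0 = size F;
  input_bits : forall j (i : 'I_n), (j < size F)%N ->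
    nmem s arr_formula (j * n + i)%N = (i \in nth set0 F j);
  input_p : forall i : 'I_n, rmem s arr_prob i = p i;
  input_c : forall i : 'I_n, rmem s arr_cost i = c i }.

Lemma has_input_unchanged P s s' :
  unchanged P s s' ->
  all (fun a => a \notin nat_writes P) [:: arr_nvars; arr_nterms; arr_formula] ->
  all (fun a => a \notin field_writes P) [:: arr_prob; arr_cost] ->
  has_input s -> has_input s'.
Proof.
move=> [UN UF] /= /and4P[H0 H1 H2 _] /and3P[H3 H4 _] [I1 I2 I3 I4 I5].
by split; rewrite ?UN ?UF //.
Qed.

Lemma nth_formula_bits (G : mdnf n) j (i : 'I_n) : (j < size G)%N ->
  nth 0%N (formula_bits G) (j * n + i) = (i \in nth set0 G j).
Proof.
elim: G j => //= A G IH [|j] jG; rewrite /formula_bits /= -/(formula_bits G) nth_cat.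
  rewrite mul0n add0n size_map size_enum_ord ltn_ord.
  by rewrite (nth_map i) ?size_enum_ord // nth_ord_enum.
rewrite size_map size_enum_ord mulSn -addnA ltnNge leq_addr /=.
by rewrite addKn IH.
Qed.

Lemma has_input_store : has_input (input_store F p c).
Proof.
split=> //=.
- by move=> j i; apply: nth_formula_bits.
- by move=> i; rewrite (nth_map i) ?size_enum_ord // nth_ord_enum.
- by move=> i; rewrite (nth_map i) ?size_enum_ord // nth_ord_enum.
Qed.

Lemma run_init_radix s : has_input s ->
  runs u init_radix s (fun s' =>
    nmem s' arr_radix 0 = radix n /\ nmem s' arr_classes 0 = (2 ^ size F)%N).
Proof.
move=> Hs; do 2!(apply: runs_seq; apply: runs_nset).
apply: (runs_for (I := fun i s => nmem s arr_classes 0 = (2 ^ i)%N)) => //.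
- by rewrite /= /mem_set /= (input_m Hs) terms_le.
- move=> i s' _ _ _ E; apply: runs_nset; rewrite /= /mem_set /= E expnS; lia.
- move=> s' [UN _]; rewrite /= /mem_set /= (input_m Hs) => ->; split=> //.
  by rewrite (UN arr_radix isT) /= /mem_set /= (input_n Hs) /radix; lia.
Qed.

Lemma run_init_power s :
  nmem s arr_radix 0 = radix n -> nmem s arr_classes 0 = (2 ^ size F)%N ->
  runs u init_power s (fun s' =>
    forall C, (C <= 2 ^ size F)%N -> nmem s' arr_power C = (radix n ^ C)%N).
Proof.
move=> HM HL; apply: runs_seq; apply: runs_nset.
apply: (runs_for (I := fun i s => forall C, (C <= i)%N ->
   nmem s arr_power C = (radix n ^ C)%N)) => //.
- by rewrite /= /mem_set /= HL classes_le.
- by case.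
- move=> i s1 _ Ei [UN _] H1; apply: runs_seq; apply: runs_nset.
  apply: (runs_for (I := fun x s => (forall C, (C <= i)%N ->
   nmem s arr_power C = (radix n ^ C)%N) /\
     nmem s arr_power i.+1 = (x * radix n ^ i)%N)) => //.
  + by rewrite /= /mem_set /= (UN arr_radix isT) /= /mem_set /= HM radix_le.
  + by split=> [C Ci|]; rewrite /= /mem_set /= Ei ?addn1 ?eqxx // -H1 // ltn_eqF.
  + move=> x s2 _ _ [UN2 _] [H2 E2]; apply: runs_nset.
    have Ei2 : nmem s2 counter1 0 = i by rewrite (UN2 counter1 isT).
    split=> [C Ci|]; rewrite /= /mem_set /= Ei2 addn1.
      by rewrite ltn_eqF // H2.
    by rewrite eqxx E2 H2 // mulSn addnC.
  + move=> s2 _ [H2]; rewrite /= /mem_set /= (UN arr_radix isT) /= /mem_set /= HM.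
    move=> E2 C; rewrite leq_eqVlt => /predU1P[->|]; first by rewrite E2 expnS.
    by rewrite ltnS; apply: H2.
- by move=> s' _; rewrite /= /mem_set /= HL.
Qed.

Lemma has_input_nset s a j v : a \notin [:: arr_nvars; arr_nterms; arr_formula] ->
  has_input s -> has_input (nset s a j v).
Proof.
rewrite !inE !negb_or => /and3P[H0 H1 H2] [I1 I2 I3 I4 I5].
by split; rewrite /= ?mem_set_neq // eq_sym.
Qed.

Lemma run_init_class s : has_input s ->
  runs u init_class s (fun s' => forall y, nmem s' arr_class y = class F y).
Proof.
move=> Hs; apply: (runs_for (I := fun i s => forall y, (y < i)%N ->
  nmem s arr_class y = class F y)) => //.
- by rewrite /= (input_n Hs) nvars_le.
- move=> i s1; rewrite /= (input_n Hs) => iN Ei U H1; pose y := Ordinal iN.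
  have Hs1 := has_input_unchanged U isT isT Hs.
  do 2!(apply: runs_seq; apply: runs_nset).
  apply: (runs_for (I := fun j s =>
    [/\ forall z, (z < i)%N -> nmem s arr_class z = class F z,
     nmem s arr_class i = class_prefix F y j &
     nmem s arr_pointer 0 = (j * n + i)%N])) => //.
  + by rewrite /= /mem_set /= (input_m Hs1) terms_le.
  + split; rewrite /= /mem_set /= ?Ei ?eqxx ?mul0n //.
    by move=> z zi; rewrite ltn_eqF // H1.
  + move=> j s2; rewrite /= /mem_set /= (input_m Hs1) => jm _ U2 [H2 E2 P2].
    have Ei2 : nmem s2 counter1 0 = i by rewrite (U2.1 counter1 isT).
    have Hs2 : has_input s2.
      by apply: has_input_unchanged U2 isT isT _; do 2!(apply: has_input_nset => //).
    apply: runs_seq; apply: runs_nset; apply: runs_nset.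
    split; rewrite /= /mem_set /= ?Ei2.
    * by move=> z zi; rewrite ltn_eqF // H2.
    * by rewrite eqxx E2 P2 (input_bits Hs2 y jm).
    * by rewrite P2 (input_n Hs2) mulSn; lia.
  + move=> s2 _; rewrite /= /mem_set /= (input_m Hs1) => -[H2 E2 _] z.
    rewrite ltnS leq_eqVlt => /predU1P[zi|]; last exact: H2.
    by have -> : z = y by apply: val_inj.
- by move=> s' _; rewrite /= (input_n Hs) => H y; apply: H.
Qed.

Lemma run_init_rank s : has_input s -> (forall y, nmem s arr_class y = class F y) ->
  runs u init_rank s (fun s' => forall y, nmem s' arr_rank y = rank p c F y).
Proof.
move=> Hs Hclass; apply: (runs_for (I := fun i s => forall y, (y < i)%N ->
  nmem s arr_rank y = rank p c F y)) => //.
- by rewrite /= (input_n Hs) nvars_le.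
- move=> i s1; rewrite /= (input_n Hs) => iN Ei U H1; pose y := Ordinal iN.
  have Hs1 := has_input_unchanged U isT isT Hs.
  pose A j := [set z | (class F z == class F y) && before p c z y && (z < j)%N].
  apply: runs_seq; apply: runs_nset.
  apply: (runs_for (I := fun j s =>
    (forall z, (z < i)%N -> nmem s arr_rank z = rank p c F z) /\
     nmem s arr_rank i = #|A j|)) => //.
  + by rewrite /= /mem_set /= (input_n Hs1) nvars_le.
  + split; rewrite /= /mem_set /= Ei.
      by move=> z zi; rewrite ltn_eqF // H1.
    rewrite eqxx; apply/esym/eqP; rewrite cards_eq0; apply/eqP/setP=> z.
    by rewrite !inE ltn0 andbF.
  + move=> j s2; rewrite /= /mem_set /= (input_n Hs1) => jn Ej U2 [H2 E2].
    pose z := Ordinal jn.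
    have Ei2 : nmem s2 counter1 0 = i by rewrite (U2.1 counter1 isT).
    have Hs2 : has_input s2.
      by apply: has_input_unchanged U2 isT isT _; apply: has_input_nset.
    have Hclass2 (w : 'I_n) : nmem s2 arr_class w = class F w.
      by rewrite (U2.1 arr_class isT) /= /mem_set /= (U.1 arr_class isT).
    apply: runs_if; rewrite /= Ei2 Ej.
    have := (Hclass2 z, Hclass2 y, input_p Hs2 z, input_p Hs2 y, input_c Hs2 z, input_c Hs2 y).
    rewrite /= => E; rewrite !E -eqn_leq -/(ratio p c z) -/(ratio p c y).
    rewrite -[X in _ && X]/(before p c z y).
    have AS : A j.+1 = if (class F z == class F y) && before p c z y
                       then z |: A j else A j.
      apply/setP=> w; case: ifP => Hz; rewrite !inE ltnS leq_eqVlt.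
        have [->|wz] := eqVneq w z; first by rewrite Hz eqxx.
        by rewrite -val_eqE /= in wz; rewrite (negbTE wz).
      have [->|wz] := eqVneq w z; first by rewrite Hz.
      by rewrite -val_eqE /= in wz; rewrite (negbTE wz).
    rewrite AS; case: ifP => Hz; last by apply: runs_skip.
    apply: runs_nset; split; rewrite /= /mem_set /= Ei2.
      by move=> w wi; rewrite ltn_eqF // H2.
    by rewrite eqxx E2 cardsU1 !inE ltnn andbF addnC.
  + move=> s2 _; rewrite /= /mem_set /= (input_n Hs1) => -[H2 E2] z.
    rewrite ltnS leq_eqVlt => /predU1P[zi|]; last exact: H2.
    have -> : z = y by apply: val_inj.
    by rewrite /= E2 /rank; apply: eq_card => w; rewrite !inE ltn_ord andbT.
- by move=> s' _; rewrite /= (input_n Hs) => H y; apply: H.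
Qed.

Record has_tables s : Prop := HasTables {
  tab_input : has_input s;
  tab_radix : nmem s arr_radix 0 = radix n;
  tab_classes : nmem s arr_classes 0 = (2 ^ size F)%N;
  tab_power : forall C, (C <= 2 ^ size F)%N -> nmem s arr_power C = (radix n ^ C)%N;
  tab_class : forall y, nmem s arr_class y = class F y;
  tab_rank : forall y, nmem s arr_rank y = rank p c F y }.

Definition table_arrays := [:: arr_nvars; arr_nterms; arr_formula; arr_radix;
  arr_classes; arr_power; arr_class; arr_rank].

Lemma has_tables_unchanged P s s' :
  unchanged P s s' ->
  all (fun a => a \notin nat_writes P) table_arrays ->
  all (fun a => a \notin field_writes P) [:: arr_prob; arr_cost] ->
  has_tables s -> has_tables s'.
Proof.
move=> [UN UF] /= /and5P[H0 H1 H2 H3 /and5P[H4 H5 H6 H7 _]] HF [I1 I2 I3 I4 I5 I6].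
split; rewrite ?UN //.
by apply: (has_input_unchanged (conj UN UF)) I1; rewrite // /= H0 H1 H2.
Qed.

Lemma has_tables_nset s a j v : a \notin table_arrays ->
  has_tables s -> has_tables (nset s a j v).
Proof.
move=> Ha [I1 I2 I3 I4 I5 I6]; move: (Ha); rewrite !inE !negb_or.
move=> /and5P[H0 H1 H2 H3 /and4P[H4 H5 H6 H7]].
split; rewrite /= ?mem_set_neq ?[_ == a]eq_sym //.
by apply: has_input_nset; rewrite ?inE ?negb_or ?H0 ?H1.
Qed.

Lemma has_tables_rset s a j v : a \notin [:: arr_prob; arr_cost] ->
  has_tables s -> has_tables (rset s a j v).
Proof.
rewrite !inE !negb_or => /andP[H0 H1] [[I1 I2 I3 I4 I5] T2 T3 T4 T5 T6].
by split=> //; split=> //= i; rewrite mem_set_neq // eq_sym.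
Qed.

Lemma num_states_gt0 : (0 < num_states F)%N.
Proof. by rewrite /num_states expn_gt0. Qed.

(** Matches the overflow test of [decode_state] with the case distinction in [modnS] and [divnS]. *)
Lemma leq_modS M x : (0 < M)%N -> (M <= (x %% M).+1)%N = (M %| x.+1)%N.
Proof.
move=> M0; rewrite /dvdn -addn1 -[x.+1]addn1 -modnDml.
have := ltn_pmod x M0; rewrite leq_eqVlt => /predU1P[E|lt].
  by rewrite addn1 E modnn leqnn.
by rewrite addn1 [in RHS]modn_small // leqNgt lt.
Qed.

Lemma run_decode_state s e : has_tables s -> nmem s arr_state 0 = e -> (e <= u)%N ->
  runs u decode_state s (fun s' =>
    forall y, nmem s' arr_digit (class F y) = progress F e y).
Proof.
move=> Hs He eu; pose M := radix n.
apply: runs_seq; apply: runs_nset.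
apply: (runs_for (I := fun C s =>
  nmem s arr_quotient 0 = (e %/ M ^ C)%N /\
  forall D, (D < C)%N -> nmem s arr_digit D = digit M e D)) => //.
- by rewrite /= /mem_set /= (tab_classes Hs) classes_le.
- by split=> //; rewrite /= /mem_set /= He divn1.
- move=> C s1 _ EC U [EQ ED]; do 2!(apply: runs_seq; apply: runs_nset).
  apply: runs_seq; apply: (runs_for (I := fun x s =>
    [/\ forall D, (D < C)%N -> nmem s arr_digit D = digit M e D,
     nmem s arr_digit C = (x %% M)%N & nmem s arr_quotient 1 = (x %/ M)%N])) => //.
  + by rewrite /= /mem_set /= EQ (leq_trans (leq_div _ _)).
  + split; rewrite /= /mem_set /= ?EC ?eqxx ?mod0n ?div0n //.
    by move=> D DC; rewrite ltn_eqF // ED.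
  + move=> x s2 _ _ U2 [HD2 HC2 HQ2].
    have EC2 : nmem s2 counter2 0 = C by rewrite (U2.1 counter2 isT).
    have EM2 : nmem s2 arr_radix 0 = M.
      rewrite (U2.1 arr_radix isT) /= /mem_set /= (U.1 arr_radix isT).
      by rewrite /= /mem_set /= (tab_radix Hs).
    apply: runs_seq; apply: runs_nset; apply: runs_if.
    rewrite /= /mem_set /= EM2 EC2 !eqxx HC2 addn1 leq_modS //.
    case: ifP => Mx.
      apply: runs_seq; do 2!apply: runs_nset.
      split; rewrite /= /mem_set /= ?EC2 ?eqxx.
      * by move=> D DC; rewrite ltn_eqF // HD2.
      * by rewrite modnS Mx.
      * by rewrite divnS // Mx HQ2 addn1.
    apply: runs_skip; split; rewrite /= /mem_set /= ?EC2 ?eqxx.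
    * by move=> D DC; rewrite ltn_eqF // HD2.
    * by rewrite modnS Mx.
    * by rewrite divnS // Mx HQ2.
  + move=> s2 _; rewrite /= /mem_set /= EQ => -[HD2 HC2 HQ2].
    apply: runs_nset; split; rewrite /= /mem_set /= ?HQ2.
      by rewrite -divnMA -expnSr.
    move=> D; rewrite ltnS leq_eqVlt => /predU1P[->|]; last exact: HD2.
    by rewrite HC2.
- move=> s' _; rewrite /= /mem_set /= (tab_classes Hs) => -[_ HD] y.
  by rewrite HD // class_lt.
Qed.

Definition has_digits e s := forall y, nmem s arr_digit (class F y) = progress F e y.

Lemma forall_ltS (A : {set 'I_n}) (a : pred 'I_n) (y : 'I_n) :
  [forall z : 'I_n, ((z < y.+1)%N && (z \in A)) ==> a z] =
  [forall z : 'I_n, ((z < y)%N && (z \in A)) ==> a z] && ((y \in A) ==> a y).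
Proof.
apply/forallP/andP => [H|[/forallP H Hy] z].
  split; last by have := H y; rewrite ltnSn.
  by apply/forallP=> z; apply/implyP=> /andP[zy zA]; have := H z; rewrite ltnS ltnW // zA.
rewrite ltnS leq_eqVlt; have [->|zy] := eqVneq z y; first by rewrite eqxx.
by rewrite -val_eqE in zy; rewrite (negbTE zy); apply: H.
Qed.

Lemma run_scan_term s e j : has_tables s -> has_digits e s -> (j < size F)%N ->
  nmem s arr_pointer 0 = (j * n)%N ->
  nmem s arr_term_alive 0 = 1%N -> nmem s arr_term_full 0 = 1%N ->
  let A := nth set0 F j in
  runs u scan_term s (fun s' =>
    [/\ nmem s' arr_pointer 0 = (j.+1 * n)%N,
     nmem s' arr_term_alive 0 = [disjoint A & dead F e] &
     nmem s' arr_term_full 0 = (A \subset tested p c F e)]).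
Proof.
move=> Hs Hd jF Hp Ha Hf A.
pose all_lt (a : pred 'I_n) i := [forall z : 'I_n, ((z < i)%N && (z \in A)) ==> a z].
have all_lt0 a : all_lt a 0%N by apply/forallP.
have all_ltn a : all_lt a n = [forall z in A, a z].
  by apply: eq_forallb => z; rewrite ltn_ord.
apply: (runs_for (I := fun i s =>
  [/\ nmem s arr_pointer 0 = (j * n + i)%N,
   nmem s arr_term_alive 0 = all_lt (fun z => z \notin dead F e) i &
   nmem s arr_term_full 0 = all_lt (fun z => z \in tested p c F e) i])) => //.
- by rewrite /= (input_n (tab_input Hs)) nvars_le.
- by split; rewrite ?all_lt0 ?addn0.
- move=> i s1; rewrite /= (input_n (tab_input Hs)) => iN Ei U [P1 A1 F1].
  have Hs1 := has_tables_unchanged U isT isT Hs.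
  pose y := Ordinal iN.
  have bit : nmem s1 arr_formula (j * n + i)%N = (y \in A).
    by have := input_bits (tab_input Hs1) y jF.
  have := (tab_class Hs1 y, tab_rank Hs1 y, tab_radix Hs1).
  rewrite /= => E.
  have dig : nmem s1 arr_digit (class F y) = progress F e y.
    by rewrite (U.1 arr_digit isT) Hd.
  have deadE : (radix n - 1 <= progress F e y)%N = (y \in dead F e).
    by rewrite inE eqn_leq progress_le /radix subn1.
  have testE : (progress F e y <= rank p c F y)%N = (y \notin tested p c F e).
    by rewrite inE -leqNgt.
  have allS a : all_lt a i.+1 = all_lt a i && ((y \in A) ==> a y) by exact: (forall_ltS A a y).
  apply: runs_seq; apply: runs_if; rewrite /= P1 bit lt0b.
  case: ifP => yA; last first.
    apply: runs_skip; apply: runs_nset.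
    by split; rewrite /= /mem_set /= ?P1 ?A1 ?F1 ?allS ?yA ?andbT // addn1 addnS.
  apply: runs_seq; apply: runs_if; rewrite /= Ei !E dig deadE.
  case: ifP => yd; [apply: runs_nset | apply: runs_skip];
  apply: runs_if; rewrite /= /mem_set /= Ei !E dig testE;
  (case: ifP => yt; [apply: runs_nset | apply: runs_skip]); apply: runs_nset;
  by split; rewrite /= /mem_set /= ?P1 ?A1 ?F1 ?allS ?yA ?yd ?yt ?(negbFE yt) ?(negbTE yt)
    ?andbT ?andbF // addn1 addnS.
- move=> s' _; rewrite /= (input_n (tab_input Hs)) !all_ltn => -[HP HA HF].
  split; first by rewrite HP mulSn addnC.
  + rewrite HA; congr nat_of_bool; rewrite disjoint_subset.
    by apply/forall_inP/subsetP => H z zA; have := H z zA; rewrite !inE.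
  + by rewrite HF; congr nat_of_bool; apply/forall_inP/subsetP.
Qed.

Lemma run_scan_formula s e : has_tables s -> has_digits e s ->
  runs u scan_formula s (fun s' =>
    nmem s' arr_alive 0 = (residual p c F e != [::]) /\
    nmem s' arr_full 0 = (set0 \in residual p c F e)).
Proof.
move=> Hs Hd; do 3!(apply: runs_seq; apply: runs_nset).
pose alive (A : {set 'I_n}) := [disjoint A & dead F e].
pose full (A : {set 'I_n}) := alive A && (A \subset tested p c F e).
apply: (runs_for (I := fun j s =>
  [/\ nmem s arr_pointer 0 = (j * n)%N, nmem s arr_alive 0 = has alive (take j F) &
   nmem s arr_full 0 = has full (take j F)])) => //.
- by rewrite /= /mem_set /= (input_m (tab_input Hs)) terms_le.
- by split; rewrite /= /mem_set /= ?take0 ?mul0n.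
- move=> j s1; rewrite /= /mem_set /= (input_m (tab_input Hs)) => jF _ U [P1 A1 F1].
  have Hs1 : has_tables s1.
    by apply: has_tables_unchanged U isT isT _; do 3!(apply: has_tables_nset => //).
  have Hd1 : has_digits e s1 by move=> y; rewrite (U.1 arr_digit isT) -Hd.
  do 2!(apply: runs_seq; apply: runs_nset); apply: runs_seq.
  set s2 := nset _ _ _ _.
  have Hs2 : has_tables s2 by do 2!(apply: has_tables_nset => //).
  apply: (runs_post (@run_scan_term s2 e j Hs2 Hd1 jF P1 erefl erefl)).
  move=> s3 U3 [P3 A3 F3]; set A := nth set0 F j in A3 F3.
  have takeS a : has a (take j.+1 F) = a A || has a (take j F).
    by rewrite (take_nth set0) // has_rcons.
  have A30 : nmem s3 arr_alive 0 = has alive (take j F) by rewrite (U3.1 arr_alive isT).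
  have F30 : nmem s3 arr_full 0 = has full (take j F) by rewrite (U3.1 arr_full isT).
  apply: runs_if; rewrite /= A3 lt0b -/(alive A).
  case: ifP => Ha; last first.
    by apply: runs_skip; rewrite !takeS /full Ha.
  apply: runs_seq; apply: runs_nset; apply: runs_if; rewrite /= /mem_set /= F3 lt0b.
  case: ifP => Hf; [apply: runs_nset | apply: runs_skip];
    by rewrite !takeS /full Ha Hf /= /mem_set.
- move=> s' _; rewrite /= /mem_set /= (input_m (tab_input Hs)) take_size => -[_ -> ->].
  split; congr nat_of_bool.
    by rewrite -size_eq0 size_map size_filter -lt0n has_count.
  apply/hasP/mapP => [[A AF /andP[Aa At]]|[A]].
    exists A; first by rewrite mem_filter; apply/andP.
    by apply/esym/eqP; rewrite setD_eq0.
  rewrite mem_filter => /andP[Aa AF] /esym/eqP; rewrite setD_eq0 => At.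
  by exists A => //; apply/andP.
Qed.

Definition done s e :=
  node_correct p c F (nmem s) e /\ rmem s arr_value e = opt p c (residual p c F e).

Definition done_after s e := forall e', (e < e' < num_states F)%N -> done s e'.

Definition best_of s e i y :=
  [/\ nmem s arr_label e = y.+2, candidate p c F e y,
   nmem s arr_child0 e = succ0 F e y, nmem s arr_child1 e = succ1 F e y &
   rmem s arr_value e = test_opt p c (residual p c F e) y /\
   forall z, (z < i)%N -> candidate p c F e z ->
     test_opt p c (residual p c F e) y <= test_opt p c (residual p c F e) z].

Definition best_so_far s e i :=
  (nmem s arr_label e = 0%N /\ forall z, (z < i)%N -> ~~ candidate p c F e z)
  \/ exists y, best_of s e i y.

Lemma done_eq s s' e :
  nmem s' arr_label e = nmem s arr_label e ->
  nmem s' arr_child0 e = nmem s arr_child0 e ->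
  nmem s' arr_child1 e = nmem s arr_child1 e ->
  rmem s' arr_value e = rmem s arr_value e -> done s e -> done s' e.
Proof. by rewrite /done /node_correct => -> -> -> ->. Qed.

Lemma run_try_candidate s e y : (e < num_states F)%N ->
  has_tables s -> has_digits e s -> nmem s arr_state 0 = e -> nmem s counter2 0 = y ->
  done_after s e -> best_so_far s e y ->
  runs u try_candidate s (fun s' => done_after s' e /\ best_so_far s' e y.+1).
Proof.
move=> eN Hs Hd Es Ey Hdone Hbest.
have dig : nmem s arr_digit (class F y) = progress F e y by [].
apply: runs_if; rewrite /= Ey (tab_class Hs) (tab_rank Hs) dig -eqn_leq.
rewrite -/(candidate p c F e y); case: ifP => Cy; last first.
  apply: runs_skip; split=> //; case: Hbest => [[El Hn]|[z [E1 Cz E2 E3 [E4 Hz]]]].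
    left; split=> // z; rewrite ltnS leq_eqVlt => /predU1P[/val_inj->|]; rewrite ?Cy //.
    exact: Hn.
  right; exists z; split=> //; split=> // w.
  by rewrite ltnS leq_eqVlt => /predU1P[/val_inj->|]; [rewrite Cy | apply: Hz].
apply: runs_seq; apply: runs_nset; apply: runs_seq.
apply: (runs_for (I := fun x s =>
  nmem s arr_address 0 = (e + x * radix n ^ class F y)%N)) => //.
- rewrite /= /mem_set /= (tab_radix Hs) (leq_trans _ radix_le) //.
  by rewrite -subnDA leq_subr.
- by rewrite /= /mem_set /= Es mul0n addn0.
- move=> x s1 _ _ U E1; apply: runs_nset; rewrite /= /mem_set /=.
  rewrite E1 (U.1 counter2 isT) (U.1 arr_class isT) (U.1 arr_power isT) /= /mem_set /=.
  by rewrite Ey (tab_class Hs) (tab_power Hs) ?mulSn; [lia | apply/ltnW/class_lt].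
move=> s1 U; rewrite /= /mem_set /= Ey (tab_class Hs) dig (tab_radix Hs).
rewrite /radix subn1 /= -/(radix n) -/(succ0 F e y) => Ea.
have U1 a : a \notin [:: arr_address; counter3] -> nmem s1 a = nmem s a.
  rewrite !inE negb_or => /andP[a1 a2]; rewrite (U.1 a); last first.
    by rewrite /= !inE !negb_or a1 a2.
  by rewrite /= mem_set_neq.
have U2 a : rmem s1 a = rmem s a by rewrite (U.2 a isT).
have Hs1 : has_tables s1.
  by apply: has_tables_unchanged U isT isT _; apply: has_tables_nset.
apply: runs_seq; apply: runs_rset.
have E1 : (e + radix n ^ class F y)%N = succ1 F e y by [].
have Epow : nmem s1 arr_power (class F y) = (radix n ^ class F y)%N.
  by rewrite (tab_power Hs1) // ltnW // class_lt.
rewrite /= Ea !U1 // Es Ey (tab_class Hs) -(U1 arr_power isT) Epow E1 !U2.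
rewrite (input_p (tab_input Hs)) (input_c (tab_input Hs)).
have [_ ->] : done s (succ1 F e y) by apply: Hdone; rewrite succ1_gt (succ1_lt eN Cy).
have [_ ->] : done s (succ0 F e y).
  by apply: Hdone; rewrite (succ0_gt Cy) succ0_lt.
rewrite residual_succ1 // residual_succ0 // -/(test_value _ _ _ _ _) -/(test_opt _ _ _ _).
set v := test_opt _ _ _ _; set s2 := rset _ _ _ _.
have D2 : done_after s2 e.
  by move=> e' /Hdone; apply: done_eq; rewrite /= /mem_set /= ?U1 ?U2.
have B2 : best_so_far s2 e y.
  by move: Hbest; rewrite /best_so_far /best_of /= /mem_set /= !U1 // !U2.
apply: runs_if; rewrite /= /mem_set /= !U1 // Es !U2.
set skip := (_ && _).
have [le_v|gt_v] := boolP skip.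
  move: le_v; rewrite /skip => /andP[l1 le_v]; apply: runs_skip; split=> //.
  case: B2 => [[El _]|[z [El Cz E2 E3 [E4 Hz]]]].
    by move: El; rewrite /= !U1 // => El; rewrite El in l1.
  right; exists z; split=> //; split=> // w; rewrite ltnS leq_eqVlt.
  move=> /predU1P[/val_inj->|]; last exact: Hz.
  by move=> _; rewrite -E4 /= /mem_set /= U2.
apply: runs_seq; apply: runs_nset; apply: runs_seq; apply: runs_nset.
apply: runs_seq; apply: runs_nset; apply: runs_rset.
have Es1 : nmem s1 arr_state 0 = e by rewrite U1.
have Ey1 : nmem s1 counter2 0 = y by rewrite U1.
rewrite /= /mem_set /= Es1 Ey1 Ea (tab_class Hs1) Epow E1; split.
  move=> e' He'; apply: done_eq (D2 e' He'); rewrite /= /mem_set /= gtn_eqF //;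
    by case/andP: He'.
right; exists y; split; rewrite /= /mem_set /= ?eqxx ?addn2 //; split=> // z.
rewrite ltnS leq_eqVlt => /predU1P[/val_inj->|zy] Cz //.
case: B2 => [[_ Hn]|[w [El Cw E2 E3 [E4 Hz]]]].
  by have := Hn z zy; rewrite Cz.
(* The earlier best w has a positive label, so the guard can only have failed because y is strictly
   cheaper. *)
apply: le_trans (Hz z zy Cz); rewrite -E4.
move: gt_v El; rewrite /skip /= U1 // => gt_v El; move: gt_v.
rewrite El /= -ltNge => /ltW.
by rewrite /= /mem_set /= U2.
Qed.

Lemma run_make_node s e : (e < num_states F)%N ->
  has_tables s -> has_digits e s -> nmem s arr_state 0 = e ->
  nmem s arr_alive 0 = (residual p c F e != [::]) ->
  nmem s arr_full 0 = (set0 \in residual p c F e) ->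
  done_after s e -> runs u make_node s (fun s' => done_after s' e /\ done s' e).
Proof.
move=> eN Hs Hd Es Ea Ef Hdone; apply: runs_seq; apply: runs_rset.
set s1 := rset _ _ _ _.
have D1 v : done_after (nset s1 arr_label e v) e.
  move=> e' He'; have ee' : (e < e')%N by case/andP: He'.
  by apply: done_eq (Hdone e' He'); rewrite /= /mem_set /= ?Es ?gtn_eqF.
apply: runs_if; rewrite /= Ef lt0b.
case: ifP => [full|/negbT not_full].
  apply: runs_nset; rewrite /= Es; split; first exact: D1.
  split; last by rewrite /= /mem_set /= Es eqxx opt_set0.
  by apply: Or31; rewrite /= /mem_set /= eqxx.
apply: runs_seq; apply: runs_nset; rewrite [neval s1 _]Es.
set s2 := nset _ _ _ _.
have Eb : beval s2 (BLeN (NConst 1) (Var arr_alive)) = (residual p c F e != [::]).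
  by rewrite /= /mem_set /= Ea lt0b.
apply: runs_if; rewrite Eb.
case: ifP => [alive|/negbFE/eqP dead_all]; last first.
  apply: runs_skip; split; first exact: D1.
  split; last by rewrite /= /mem_set /= Es eqxx dead_all opt_nil.
  by apply: Or32; rewrite /= /mem_set /= eqxx.
have Hs2 : has_tables s2 by apply: has_tables_nset => //; apply: has_tables_rset.
have En : neval s2 NVars = n := input_n (tab_input Hs2).
apply: (runs_for (I := fun i s => done_after s e /\ best_so_far s e i)) => //.
- by rewrite En nvars_le.
- by split; [apply: D1 | left; rewrite /= /mem_set /= eqxx].
- move=> i s3; rewrite En => iN Ei U [D3 B3].
  have Hs3 := has_tables_unchanged U isT isT Hs2.
  apply: (@run_try_candidate s3 e (Ordinal iN)) => //.
    by move=> y; rewrite (U.1 arr_digit isT) -Hd.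
  by rewrite (U.1 arr_state isT) -Es.
move=> s3 U; rewrite En => -[D3 B3]; split=> //.
(* As a candidate exists, the label cannot have kept its initial value 0. *)
have [z Cz] := candidate_exists p01 c_ge0 not_full alive.
case: B3 => [[_ /(_ z (ltn_ord z))]|[y [El Cy E0 E1 [Ev Hy]]]]; first by rewrite Cz.
have Eo : opt p c (residual p c F e) = test_opt p c (residual p c F e) y.
  by apply: opt_candidates => // w; apply: Hy.
by split; [apply: Or33; exists y | rewrite Ev].
Qed.

Lemma run_fill_table s : has_tables s ->
  runs u fill_table s (fun s' => forall e, (e < num_states F)%N -> done s' e).
Proof.
move=> Hs; have NE s' : has_tables s' ->
    nmem s' arr_power (nmem s' arr_classes 0%N) = num_states F.
  by move=> Hs'; rewrite (tab_classes Hs') (tab_power Hs').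
apply: (runs_for (I := fun x s => forall e, (num_states F - x <= e < num_states F)%N ->
   done s e)) => //.
- by rewrite /= NE.
- by move=> e; rewrite subn0 => /andP[/leq_ltn_trans H /H]; rewrite ltnn.
- move=> x s1; rewrite /= NE // => xN Ex U D1.
  have Hs1 := has_tables_unchanged U isT isT Hs.
  apply: runs_seq; apply: runs_nset; rewrite /= NE // Ex.
  set e := (_ - 1 - x)%N; set s2 := nset _ _ _ _.
  have eN : (e < num_states F)%N by rewrite /e; lia.
  have Hs2 : has_tables s2 by apply: has_tables_nset.
  apply: runs_seq; apply: (runs_post (@run_decode_state s2 e Hs2 erefl _)).
    exact/(leq_trans _ u_ge)/ltnW.
  move=> s3 U3 Hd3; have Hs3 := has_tables_unchanged U3 isT isT Hs2.
  apply: runs_seq; apply: (runs_post (run_scan_formula Hs3 Hd3)).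
  move=> s4 U4 [A4 F4]; have Hs4 := has_tables_unchanged U4 isT isT Hs3.
  have D4 : done_after s4 e.
    move=> e' /andP[ee' e'N]; have : done s1 e' by apply: D1; rewrite e'N /e in ee' *; lia.
    by apply: done_eq; rewrite ?(U4.1 arr_label isT) ?(U4.1 arr_child0 isT)
      ?(U4.1 arr_child1 isT) ?(U4.2 arr_value isT) ?(U3.1 arr_label isT)
      ?(U3.1 arr_child0 isT) ?(U3.1 arr_child1 isT) ?(U3.2 arr_value isT).
  apply: (runs_weaken (@run_make_node s4 e eN Hs4 _ _ A4 F4 D4)).
  + by move=> y; rewrite (U4.1 arr_digit isT).
  + by rewrite (U4.1 arr_state isT) (U3.1 arr_state isT).
  + move=> s5 [D5 De] e' He'; have [->//|neq] := eqVneq e' e.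
    by apply: D5; move: neq He'; rewrite /e; lia.
- by move=> s' _; rewrite /= NE // subnn => D e eN; apply: D.
Qed.

Lemma run_dnf_program :
  runs u dnf_program (input_store F p c) (fun s =>
    exists2 t, outputs_tree s t & optimal_strategy p c F t).
Proof.
have H0 := has_input_store; set s0 := input_store F p c in H0 *.
apply: runs_seq; apply: (runs_post (run_init_radix H0)) => s1 U1 [M1 L1].
have H1 := has_input_unchanged U1 isT isT H0.
apply: runs_seq; apply: (runs_post (run_init_power M1 L1)) => s2 U2 P2.
have H2 := has_input_unchanged U2 isT isT H1.
apply: runs_seq; apply: (runs_post (run_init_class H2)) => s3 U3 C3.
have H3 := has_input_unchanged U3 isT isT H2.
apply: runs_seq; apply: (runs_post (run_init_rank H3 C3)) => s4 U4 R4.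
have T4 : has_tables s4.
  split=> //.
  - exact: has_input_unchanged U4 isT isT H3.
  - by rewrite (U4.1 arr_radix isT) (U3.1 arr_radix isT) (U2.1 arr_radix isT).
  - by rewrite (U4.1 arr_classes isT) (U3.1 arr_classes isT) (U2.1 arr_classes isT).
  - by move=> C; rewrite (U4.1 arr_power isT) (U3.1 arr_power isT); apply: P2.
  - by move=> y; rewrite (U4.1 arr_class isT).
have R0 : nmem s4 arr_root 0 = 0%N.
  by rewrite (U4.1 arr_root isT) (U3.1 arr_root isT) (U2.1 arr_root isT) (U1.1 arr_root isT).
apply: (runs_post (run_fill_table T4)) => s5 U5 D5.
have [|t St Ot] := stored_opt_tree (fun e eN => (D5 e eN).1) (e := 0).
  exact: num_states_gt0.
exists t; first by rewrite /outputs_tree (U5.1 arr_root isT) R0.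
by rewrite residual0 in Ot; apply: opt_tree_strategy Ot.
Qed.

End Correctness.

Theorem theorem5 (R : realFieldType) (k : nat) :
  exists (P : cmd) (T : {poly nat}),
    forall (n : nat) (F : mdnf n) (p c : 'I_n -> R),
      (size F <= k)%N ->
      (forall i, 0 < p i < 1) ->
      (forall i, 0 <= c i) ->
      exists (steps : nat) (s : store R) (t : dtree n),
        [/\ exec P (input_store F p c) steps s,
            (steps <= T.[n])%N,
            outputs_tree s t
          & optimal_strategy p c F t].
Proof.
(* A state has at most [2 ^ k] digits in base n + 2. The resulting bound on the number of states
   also bounds the rounds of every loop, so it is substituted into [time_bound]. *)
exists dnf_program, (time_bound dnf_program \Po ('X + 2%:P) ^+ (2 ^ k)).
move=> n F p c Fk p01 c_ge0.
have u_ge : (num_states F <= (n + 2) ^ 2 ^ k)%N.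
  by rewrite /num_states /radix -addn2 leq_exp2l ?leq_exp2l // addn2.
have [steps [s [E Hsteps [t St Ot]]]] := run_dnf_program p01 c_ge0 u_ge.
exists steps, s, t; split=> //.
move: (time_bound dnf_program) Hsteps => B; rewrite horner_comp horner_exp.
by rewrite hornerD hornerX hornerC natrXE.
Qed.
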